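(* Let $p\ge 3$ and $n\geq 2p+2$, and let $A$ be an $n$-dimensional naturally graded complex Zinbiel algebra of type $I$ with characteristic sequence equal to $(n-p,p)$. Then $A$ is isomorphic to one of the following pairwise non-isomorphic algebras, each given on a basis $\{e_1,\dots,e_{n-p},f_1,\dots,f_p\}$ (indices $i,j\ge 1$, $\beta_0=1$, omitted products are zero): $A_1$ (one algebra for each parameter $\beta_1\in\mathbb{C}$): $$e_i\circ e_j=C_{i+j-1}^{j}e_{i+j},\quad 2\leq i+j\leq n-p,$$ $$e_i\circ f_j=\sum_{k=0}^{i-1}C_{i+j-2-k}^{j-1}\beta_k f_{i+j},\qquad f_i\circ e_j=\sum_{k=0}^{j}C_{i+j-2-k}^{i-2}\beta_k f_{i+j},\quad 2\leq i+j\leq p,$$ where $\beta_{i+1}=\prod_{k=0}^{i}\frac{k+\beta_1}{k+1}$ for $1\leq i\leq p-2$; $A_2$: $$e_i\circ e_j=C_{i+j-1}^{j}e_{i+j},\quad 2\leq i+j\leq n-p,\qquad f_1\circ f_{p-1}=f_p,$$ $$e_i\circ f_j=\sum_{k=0}^{i-1}C_{i+j-2-k}^{j-1}\beta_k f_{i+j},\qquad f_i\circ e_j=\sum_{k=0}^{j}C_{i+j-2-k}^{i-2}\beta_k f_{i+j},\quad 2\leq i+j\leq p,$$ where $\beta_i=(-1)^iC_{p-2}^{i}$ for $1\leq i\leq p-2$ and $\beta_{p-1}=0$; $A_3$: $$e_i\circ e_j=C_{i+j-1}^{j}e_{i+j},\quad 2\leq i+j\leq n-p,$$ $$e_i\circ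 f_j=f_i\circ e_j=f_i\circ f_j=C_{i+j-1}^{j}f_{i+j},\quad 2\leq i+j\leq p.$$
   Context: All algebras are finite-dimensional over $\mathbb{C}$. A Zinbiel algebra is an algebra $A$ with multiplication $\circ$ satisfying $(x\circ y)\circ z=x\circ(y\circ z)+x\circ(z\circ y)$ for all $x,y,z$. Put $A^1=A$, $A^{k+1}=A\circ A^k$. (Finite-dimensional complex Zinbiel algebras are nilpotent.) If $s$ is minimal with $A^s=0$, put $A_i=A^i/A^{i+1}$ and $\operatorname{gr}A=A_1\oplus\cdots\oplus A_{s-1}$ with the induced graded multiplication; $A$ is naturally graded if $A\cong\operatorname{gr}A$. For $x\in A\setminus A^2$ let $L_x(y)=x\circ y$ and let $C(x)$ be the descending sequence of sizes of the Jordan blocks of the operator $L_x$. The characteristic sequence is $C(A)=\max_{x\in A\setminus A^2}C(x)$ in the lexicographic order. If $C(A)=(n-p,p)$, $n\geq 2p$, there is a basis of $A$ with first element $e_1$ in which the matrix of $L_{e_1}$ is block diagonal with (nilpotent) Jordan blocks either $(J_{n-p},J_p)$ or $(J_p,J_{n-p})$ in this order. $A$ is of type $I$ if the form is $(J_{n-p},J_p)$, i.e. there is a basis $\{e_1,\dots,e_{n-p},f_1,\dots,f_p\}$ with $e_1\circ e_i=e_{i+1}$ $(1\le i\le n-p-1)$, $e_1\circ e_{n-p}=0$, $e_1\circ f_i=f_{i+1}$ $(1\le i\le p-1)$, $e_1\circ f_p=0$; otherwise it is of type $II$. $C_a^b=\binom{a}{b}$ is the binomial coefficient, with the conventions $C_{-1}^{-1}=1$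 and $C_m^{-1}=0$ for $m\ge 0$ (so that the formula for $f_i\circ e_j$ with $i=1$ reads $f_1\circ e_j=\beta_j f_{j+1}$). *)

(* Defs.v *)
From HB Require Import structures.
From mathcomp Require Import all_boot all_order all_algebra.
From mathcomp Require Import sesquilinear.
From mathcomp Require Import reals complex.

Set Implicit Arguments.
Unset Strict Implicit.
Unset Printing Implicit Defensive.

Import Order.TTheory GRing.Theory Num.Theory.
Local Open Scope ring_scope.

(* External direct sum of a finite family of (left) modules. *)

Definition dsum (K : fieldType) (I : finType) (T : I -> lmodType K) : Type :=
  {dffun forall i : I, T i}.

Section DirectSum.
Variables (K : fieldType) (I : finType) (T : I -> lmodType K).
Implicit Types x y z : dsum T.

HB.instance Definition _ := Choice.on (dsum T).

Definition dsum_fun x : forall i, T i := fun i => (x : {dffun forall i, T i}) i.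

Definition dsum_of (f : forall i, T i) : dsum T :=
  [ffun i => f i] : {dffun forall i, T i}.

Lemma dsum_ofE f i : dsum_fun (dsum_of f) i = f i.
Proof. by rewrite /dsum_fun ffunE. Qed.

Lemma dsumP x y : (forall i, dsum_fun x i = dsum_fun y i) -> x = y.
Proof. by move=> eq_xy; apply/ffunP. Qed.

Definition dsum_zero := dsum_of (fun i => 0).
Definition dsum_opp x := dsum_of (fun i => - dsum_fun x i).
Definition dsum_add x y := dsum_of (fun i => dsum_fun x i + dsum_fun y i).
Definition dsum_scale (a : K) x := dsum_of (fun i => a *: dsum_fun x i).

Fact dsum_addA : associative dsum_add.
Proof. by move=> x y z; apply: dsumP => i; rewrite !dsum_ofE addrA. Qed.
Fact dsum_addC : commutative dsum_add.
Proof. by move=> x y; apply: dsumP => i; rewrite !dsum_ofE addrC. Qed.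
Fact dsum_add0 : left_id dsum_zero dsum_add.
Proof. by move=> x; apply: dsumP => i; rewrite !dsum_ofE add0r. Qed.
Fact dsum_addN : left_inverse dsum_zero dsum_opp dsum_add.
Proof. by move=> x; apply: dsumP => i; rewrite !dsum_ofE addNr. Qed.

HB.instance Definition _ := GRing.isZmodule.Build (dsum T)
  dsum_addA dsum_addC dsum_add0 dsum_addN.

Fact dsum_scaleA a b x : dsum_scale a (dsum_scale b x) = dsum_scale (a * b) x.
Proof. by apply: dsumP => i; rewrite !dsum_ofE scalerA. Qed.
Fact dsum_scale1 : left_id 1 dsum_scale.
Proof. by move=> x; apply: dsumP => i; rewrite !dsum_ofE scale1r. Qed.
Fact dsum_scaleDr : right_distributive dsum_scale +%R.
Proof. by move=> a x y; apply: dsumP => i; rewrite !dsum_ofE scalerDr. Qed.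
Fact dsum_scaleDl x : {morph dsum_scale^~ x : a b / a + b}.
Proof. by move=> a b; apply: dsumP => i; rewrite !dsum_ofE scalerDl. Qed.

HB.instance Definition _ := GRing.Zmodule_isLmodule.Build K (dsum T)
  dsum_scaleA dsum_scale1 dsum_scaleDr dsum_scaleDl.

End DirectSum.

(* The quotient U / W of a subspace U by a subspace W of U, realized on the
   complement U :\: W; the lemmas quot_pi_surj and quot_pi_eq0 say that quot_pi
   restricted to U is a surjection with kernel W. *)

Section Quotient.
Variables (K : fieldType) (V : vectType K) (U W : {vspace V}).

Definition quotv : vectType K := subvs_of (U :\: W)%VS.

Definition quot_pi (x : V) : quotv := vsproj (U :\: W)%VS (addv_pi1 U W x).

Definition quot_repr (q : quotv) : V := vsval q.

Lemma quot_reprP q : quot_repr q \in U.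
Proof. exact: (subvP (diffvSl U W)) (subvsP q). Qed.

Lemma quot_reprK : cancel quot_repr quot_pi.
Proof.
move=> q; rewrite /quot_pi /quot_repr daddv_pi_id ?vsvalK ?subvsP //.
by rewrite capv_diff.
Qed.

Lemma quot_piB x y : quot_pi (x - y) = quot_pi x - quot_pi y.
Proof. by rewrite /quot_pi !linearB. Qed.

Lemma quot_pi_surj q : exists2 x, x \in U & quot_pi x = q.
Proof. by exists (quot_repr q); [apply: quot_reprP | apply: quot_reprK]. Qed.

Lemma quot_pi_eq0 x : x \in U -> (quot_pi x == 0) = (x \in W).
Proof.
move=> Ux; apply/eqP/idP => [pix0|Wx].
  have pi1x0 : addv_pi1 U W x = 0.
    by rewrite -(vsprojK (memv_pi (U :\: W) W x)) [vsproj _ _]pix0 linear0.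
  rewrite -(@addv_pi1_pi2 _ _ U W x) ?pi1x0 ?add0r ?memv_pi //.
  exact: (subvP (addvSl U W)).
rewrite /quot_pi; have := @addv_pi1_pi2 _ _ U W x.
rewrite (subvP (addvSl U W)) // => /(_ isT).
rewrite [addv_pi2 U W x]daddv_pi_id //; last by rewrite capvC capv_diff.
by move=> /(canRL (addrK _)) ->; rewrite subrr linear0.
Qed.

End Quotient.

Section Algebras.
Variable K : fieldType.

Definition alg_iso (V W : lmodType K)
    (mulV : V -> V -> V) (mulW : W -> W -> W) : Prop :=
  exists phi : {linear V -> W},
    bijective phi /\ (forall x y, phi (mulV x y) = mulW (phi x) (phi y)).

Section OneAlgebra.
Variables (V : vectType K) (mul : {bilinear V -> V -> V}).
Local Notation "x ** y" := (mul x y) (at level 40, left associativity).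

Definition zinbiel : Prop :=
  forall x y z, (x ** y) ** z = x ** (y ** z) + x ** (z ** y).

Definition mulv (U W : {vspace V}) : {vspace V} :=
  <<[seq u ** w | u <- vbasis U, w <- vbasis W]>>%VS.

Lemma mulvP (U W S : {vspace V}) :
  reflect (forall u w, u \in U -> w \in W -> u ** w \in S) (mulv U W <= S)%VS.
Proof.
apply: (iffP span_subvP) => [sS u w Uu Ww | sS _ /allpairsP[[u w] /= [Uu Ww ->]]].
  rewrite (coord_vbasis Uu) (coord_vbasis Ww) linear_sumlz memv_suml // => i _.
  rewrite linear_sumr memv_suml // => j _.
  rewrite linearZl_LR linearZr_LR /= !memvZ // sS //.
  by apply: allpairs_f; rewrite mem_nth ?size_tuple.
by apply: sS; apply: vbasis_mem.
Qed.

(* alg_pow k is A^k; the powers start at A^1 = A, and the value at 0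
   is never used. *)
Fixpoint alg_pow (k : nat) : {vspace V} :=
  if k is k'.+1 then
    if k' is 0 then fullv else mulv fullv (alg_pow k')
  else fullv.

Lemma alg_powS k : (0 < k)%N -> alg_pow k.+1 = mulv fullv (alg_pow k).
Proof. by case: k. Qed.

Lemma alg_pow_mul : zinbiel -> forall i j x y, (0 < i)%N -> (0 < j)%N ->
  x \in alg_pow i -> y \in alg_pow j -> x ** y \in alg_pow (i + j).
Proof.
move=> zin i j; move En: (i + j)%N => n.
elim: n i j En => [|n IHn] [|[|i]] j // En x y _ j_gt0 Ax Ay.
  move: En; rewrite add1n => -[<-]; rewrite alg_powS //.
  by apply: (elimT (mulvP _ _ _) (subvv _)) => //; apply: memvf.
have n_gt0 : (0 < n)%N by case: n En {IHn}.
have {}En : (i.+1 + j)%N = n by case: En.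
pose S := (alg_pow n.+1 : {vspace V}).
suff AiS: forall a b, b \in alg_pow i.+1 -> (a ** b) ** y \in S.
  rewrite alg_powS // /mulv in Ax; set t := [seq _ | _ <- _, _ <- _] in Ax.
  rewrite (@coord_span _ _ _ (in_tuple t) x Ax) linear_sumlz memv_suml // => l _.
  rewrite linearZl_LR memvZ //.
  have /allpairsP[[a b] /= [_ Bb ->]] : t`_l \in t by apply: mem_nth.
  by apply: AiS; apply: vbasis_mem.
move=> a b Ab; rewrite zin /S alg_powS // memvD //;
  apply: (elimT (mulvP _ _ _) (subvv _)); rewrite ?memvf //.
  exact: (IHn _ _ En).
by apply: (IHn j i.+1) => //; rewrite addnC.
Qed.

Definition nilindex (s : nat) : Prop :=
  [/\ (0 < s)%N, alg_pow s = 0%VS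
    & forall t, (0 < t)%N -> alg_pow t = 0%VS -> (s <= t)%N].

(* gr_comp i is the component of degree i.+1, i.e. A^(i+1) / A^(i+2). *)
Definition gr_comp (i : nat) : vectType K :=
  quotv (alg_pow i.+1) (alg_pow i.+2).

Definition gr_pi (i : nat) (x : V) : gr_comp i := quot_pi _ _ x.

Definition gr (s : nat) : lmodType K := dsum (fun i : 'I_s.-1 => gr_comp i).

(* Degrees are shifted by one: the component of degree k.+1 collects the
   products of components of degrees i.+1 and j.+1 with i.+1 + j.+1 = k.+1. *)
Definition gr_mul (s : nat) (x y : gr s) : gr s :=
  dsum_of (fun k : 'I_s.-1 =>
    \sum_(i < s.-1) \sum_(j < s.-1 | (i.+1 + j.+1 == k.+1)%N)
      gr_pi k (quot_repr (dsum_fun x i) ** quot_repr (dsum_fun y j))).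

(* The multiplication of gr A does not depend on the representatives. *)
Lemma gr_piM i j k u v : zinbiel -> (i.+1 + j.+1 = k.+1)%N ->
  u \in alg_pow i.+1 -> v \in alg_pow j.+1 ->
  gr_pi k (quot_repr (gr_pi i u) ** quot_repr (gr_pi j v)) = gr_pi k (u ** v).
Proof.
move=> zin Ek Au Av.
have Arepr l w : w \in alg_pow l.+1 ->
    (quot_repr (gr_pi l w) \in alg_pow l.+1)
    /\ (quot_repr (gr_pi l w) - w \in alg_pow l.+2).
  move=> Aw; have Arw := quot_reprP (gr_pi l w); split=> //.
  rewrite -(@quot_pi_eq0 _ _ (alg_pow l.+1)) ?memvB //.
  by rewrite quot_piB quot_reprK subrr.
have [Au' du] := Arepr _ _ Au; have [Av' dv] := Arepr _ _ Av.
set u' := quot_repr _ in Au' du *; set v' := quot_repr _ in Av' dv *.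
apply/eqP; rewrite -subr_eq0 -quot_piB quot_pi_eq0; last first.
  by rewrite memvB // -Ek alg_pow_mul.
have -> : u' ** v' - u ** v = (u' - u) ** v' + u ** (v' - v).
  by rewrite linearBl linearBr /= addrA subrK.
rewrite memvD //.
  by rewrite -Ek -addSn alg_pow_mul.
by rewrite -Ek -addnS alg_pow_mul.
Qed.

Definition naturally_graded : Prop :=
  exists2 s, nilindex s & alg_iso mul (@gr_mul s).

(* d lists the sizes of the Jordan blocks of f, in descending order: there is
   a basis of V, cut into chains b_0, b_1, ... of lengths d_0, d_1, ..., in
   which the matrix of f is block diagonal with Jordan blocks of eigenvalues
   lam_k.  The default value 0 of nth makes f b_{k,i} = lam_k b_{k,i} at the end
   of a chain. *)
Definition jordan_sizes (f : V -> V) (d : seq nat) : Prop :=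
  [/\ sorted geq d, all (leq 1) d
    & exists (lam : seq K) (b : seq (seq V)),
      [/\ size lam = size d, shape b = d, basis_of fullv (flatten b)
        & forall k i, (k < size d)%N -> (i < nth 0%N d k)%N ->
            f (nth [::] b k)`_i
              = lam`_k *: (nth [::] b k)`_i + (nth [::] b k)`_i.+1]].

(* C(A) = d; seqlexi nat is seq nat with the lexicographic order. *)
Definition char_seq (d : seq nat) : Prop :=
  (exists2 x, x \notin alg_pow 2 & jordan_sizes (mul x) d) /\
  (forall y d', y \notin alg_pow 2 -> jordan_sizes (mul y) d' ->
     ((d' : seqlexi nat) <= (d : seqlexi nat))%O).

(* Type I, for an algebra of characteristic sequence (m, p). *)
Definition type_I (m p : nat) : Prop :=
  exists e f : nat -> V,
    [/\ basis_of fullv ([seq e i | i <- iota 1 m] ++ [seq f i | i <- iota 1 p]),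
        forall i, (1 <= i <= m - 1)%N -> e 1%N ** e i = e i.+1,
        e 1%N ** e m = 0,
        forall i, (1 <= i <= p - 1)%N -> e 1%N ** f i = f i.+1
      & e 1%N ** f p = 0].

End OneAlgebra.

(* Algebras given by a multiplication table on a basis e_1 .. e_m, f_1 .. f_p:
   the vectors e_k, f_k of 'rV_(m + p) with a 1-based index k are 0 when k is
   out of range, and the four functions ee, ef, fe, ff of the 1-based indices
   i, j give e_i o e_j, e_i o f_j, f_i o e_j, f_i o f_j. *)
Section Tables.
Variables m p : nat.
Local Notation V := 'rV[K]_(m + p).

Definition evec (k : nat) : V :=
  \row_l ((1 <= k <= m)%N && (l == k.-1 :> nat))%:R.

Definition fvec (k : nat) : V :=
  \row_l ((1 <= k <= p)%N && (l == (m + k.-1)%N :> nat))%:R.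

Section Table.
Variables ee ef fe ff : nat -> nat -> V.

Definition table (a b : 'I_(m + p)) : V :=
  match split a, split b with
  | inl i, inl j => ee i.+1 j.+1
  | inl i, inr j => ef i.+1 j.+1
  | inr i, inl j => fe i.+1 j.+1
  | inr i, inr j => ff i.+1 j.+1
  end.

Definition table_mul (x y : V) : V :=
  \sum_(a < m + p) \sum_(b < m + p) (x 0 a * y 0 b) *: table a b.

Fact table_mul_bilinear :
  bilinear_for (GRing.Scale.Law.clone _ _ *:%R _)
    (GRing.Scale.Law.clone _ _ *:%R _) table_mul.
Proof.
split=> [y|x] c u v /=; rewrite /table_mul scaler_sumr -big_split /=;
  apply: eq_bigr => a _; rewrite scaler_sumr -big_split /=;
  apply: eq_bigr => b _; rewrite scalerA -scalerDl !mxE.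
  by rewrite mulrDl mulrA.
by rewrite mulrDr mulrCA.
Qed.

HB.instance Definition _ := bilinear_isBilinear.Build K V V V _ _ table_mul
  table_mul_bilinear.

Lemma evecE (i : 'I_m) : evec i.+1 = delta_mx 0 (lshift p i).
Proof. by apply/rowP=> l; rewrite !mxE /= ltn_ord -val_eqE. Qed.

Lemma fvecE (j : 'I_p) : fvec j.+1 = delta_mx 0 (rshift m j).
Proof. by apply/rowP=> l; rewrite !mxE /= ltn_ord -val_eqE. Qed.

Lemma table_mul_delta a b :
  table_mul (delta_mx 0 a) (delta_mx 0 b) = table a b.
Proof.
rewrite /table_mul (bigD1 a) //= (bigD1 b) //= !mxE !eqxx mulr1 scale1r.
rewrite !big1 ?addr0 // => [i ia|i ib]; last by rewrite !mxE (negPf ib) mulr0 scale0r.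
by apply: big1 => j _; rewrite !mxE (negPf ia) mul0r scale0r.
Qed.

Let splitl (i : 'I_m) : split (lshift p i) = inl i := unsplitK (inl i).
Let splitr (j : 'I_p) : split (rshift m j) = inr j := unsplitK (inr j).

Lemma table_mul_ee i j : (1 <= i <= m)%N -> (1 <= j <= m)%N ->
  table_mul (evec i) (evec j) = ee i j.
Proof.
case: i j => [//|i] [//|j] /= im jm.
by rewrite (evecE (Ordinal im)) (evecE (Ordinal jm)) table_mul_delta /table !splitl.
Qed.

Lemma table_mul_ef i j : (1 <= i <= m)%N -> (1 <= j <= p)%N ->
  table_mul (evec i) (fvec j) = ef i j.
Proof.
case: i j => [//|i] [//|j] /= im jp.
by rewrite (evecE (Ordinal im)) (fvecE (Ordinal jp)) table_mul_delta /table splitl splitr.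
Qed.

Lemma table_mul_fe i j : (1 <= i <= p)%N -> (1 <= j <= m)%N ->
  table_mul (fvec i) (evec j) = fe i j.
Proof.
case: i j => [//|i] [//|j] /= ip jm.
by rewrite (fvecE (Ordinal ip)) (evecE (Ordinal jm)) table_mul_delta /table splitl splitr.
Qed.

Lemma table_mul_ff i j : (1 <= i <= p)%N -> (1 <= j <= p)%N ->
  table_mul (fvec i) (fvec j) = ff i j.
Proof.
case: i j => [//|i] [//|j] /= ip jp.
by rewrite (fvecE (Ordinal ip)) (fvecE (Ordinal jp)) table_mul_delta /table !splitr.
Qed.

End Table.

(* Binomial coefficient C_a^b on integers, with C_{-1}^{-1} = 1 and
   C_a^{-1} = 0 for a >= 0; the other negative arguments never occur. *)
Definition binz (a b : int) : nat :=
  match a, b with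
  | Posz a', Posz b' => 'C(a', b')
  | Negz 0, Negz 0 => 1
  | _, _ => 0
  end.

Definition tab_ee (i j : nat) : V :=
  if (i + j <= m)%N then 'C(i + j - 1, j)%:R *: evec (i + j) else 0.

Definition tab_ef (beta : nat -> K) (i j : nat) : V :=
  if (i + j <= p)%N then
    (\sum_(0 <= k < i)
       (binz (i%:Z + j%:Z - 2 - k%:Z) (j%:Z - 1))%:R * beta k) *: fvec (i + j)
  else 0.

Definition tab_fe (beta : nat -> K) (i j : nat) : V :=
  if (i + j <= p)%N then
    (\sum_(0 <= k < j.+1)
       (binz (i%:Z + j%:Z - 2 - k%:Z) (i%:Z - 2))%:R * beta k) *: fvec (i + j)
  else 0.

Definition tab_f (i j : nat) : V :=
  if (i + j <= p)%N then 'C(i + j - 1, j)%:R *: fvec (i + j) else 0.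

(* The cases i = 0 and i = 1 of the product are beta_0 = 1 and beta_1 = b. *)
Definition beta1 (b : K) (i : nat) : K :=
  \prod_(0 <= k < i) ((k%:R + b) / k.+1%:R).

(* The cases i = 0 and i = p - 1 are beta_0 = 1 and beta_(p-1) = 0. *)
Definition beta2 (i : nat) : K := (-1) ^+ i * 'C(p - 2, i)%:R.

Definition algA1 (b : K) : {bilinear V -> V -> V} :=
  table_mul tab_ee (tab_ef (beta1 b)) (tab_fe (beta1 b)) (fun _ _ => 0).

Definition algA2 : {bilinear V -> V -> V} :=
  table_mul tab_ee (tab_ef beta2) (tab_fe beta2)
    (fun i j => if (i == 1)%N && (j == p - 1)%N then fvec p else 0).

Definition algA3 : {bilinear V -> V -> V} :=
  table_mul tab_ee tab_f tab_f tab_f.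

End Tables.
End Algebras.

(* Main.v *)
From HB Require Import structures.
Require Import Defs.
From mathcomp Require Import all_boot all_order all_algebra.
From mathcomp Require Import sesquilinear.
From mathcomp Require Import reals complex.
From mathcomp Require Import zify ring.

(** Write $m = n - p$ and $L = L_{e_1}$, where $e_1, f_1$ come from type I.

    Homogeneous generators.  Let $x$ and $y$ be the parts of degree $1$ of $e_1$
    and $f_1$.  If they were dependent, $A$ would be generated by one element,
    and counting dimensions excludes this ([xy_indep]).  Hence
    $A^2 = e_1 \circ A$, and the Zinbiel identity turns this into
    $A_{j+1} = x \circ A_j$ ([pi_left_multiples]).  Consequently $A$ is spanned
    by the vectors $L_x^i x$ and $L_x^i y$.  Taking parts of lowest degree in
    $L^m e_1 = 0$ and $L^p f_1 = 0$ gives $L_x^m x = 0$ and $L_x^p y = 0$, so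
    that $m + p = n$ of these vectors already span $A$ and form a basis
    ([homogeneous_adapted]).  From now on $e_1 = x$ and $f_1 = y$ are
    homogeneous.

    Products of chains.  As $(x \circ u) \circ v = x \circ (u \circ v + v \circ u)$,
    all products are determined by the products $f_1 \circ e_j$ and
    $f_1 \circ f_j$, through a Pascal recursion ([mul_chains]) whose solutions
    are the binomial sums of the tables.  The vector $e_{p+2}$, which is nonzero
    because $n \ge 2p + 2$, prevents $f_1 \circ e_1$ from having a component
    along $e_2$ ([adapted_yx]), so $f_1 \circ e_1 = b f_2$, and $b = \beta_1$
    determines all $\beta_j$ ([y_X]).  Comparing $(f_1 \circ f_1) \circ e_1$ with
    $(f_1 \circ e_1) \circ f_1$ shows that $b = 1$ or $f_1 \circ f_1 = 0$ ([y_y]).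
    For $b = 1$ one finds $f_1 \circ f_l = c f_{l+1}$ for all $l$ ([y_Y_eq1]),
    which is $A_1$ with $\beta_1 = 1$ if $c = 0$ and is $A_3$ after a rescaling
    of $f_1$ otherwise.  For $b \ne 1$ all $f_1 \circ f_l$ vanish, except that
    $f_1 \circ f_{p-1} = c f_p$ is possible when $b = 2 - p$ ([y_Y_neq1]); this
    gives $A_1$ and $A_2$.

    Non-isomorphism.  Each of the three tables is graded, and an isomorphism is
    examined through its leading terms.  Modulo higher degree, $f_1$ must go to
    a multiple of $f_1$ if $f_1 \circ f_1 = 0$ in the source; so
    $f_1 \circ f_1 = 0$ in the target as well, and the value of $\beta_1$ is the
    same ([iso_lead]).  The product $f_1 \circ f_{p-1}$ separates $A_2$ from
    $A_1$ ([iso_last]). *)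

Import GRing.Theory.
Import Num.Theory.
Local Open Scope ring_scope.

Set Implicit Arguments.
Unset Strict Implicit.
Unset Printing Implicit Defensive.

(** * Structure constants *)

Section StructureConstants.
Variable K : numFieldType.
Implicit Types (b : K) (beta : nat -> K).

Definition coef_ef beta (i j : nat) : K :=
  \sum_(0 <= k < i)
     (binz (i%:Z + j%:Z - 2 - k%:Z) (j%:Z - 1))%:R * beta k.

Definition coef_fe beta (i j : nat) : K :=
  \sum_(0 <= k < j.+1)
     (binz (i%:Z + j%:Z - 2 - k%:Z) (i%:Z - 2))%:R * beta k.

Lemma coef_efE beta i j :
  coef_ef beta i.+1 j.+1 = \sum_(0 <= k < i.+1) 'C(i + j - k, j)%:R * beta k.
Proof.
apply: eq_big_nat => k /andP[_ ki]; congr (_%:R * _).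
have -> : i.+1%:Z + j.+1%:Z - 2 - k%:Z = Posz (i + j - k) by lia.
by have -> : j.+1%:Z - 1 = Posz j by lia.
Qed.

Lemma coef_fe1 beta j : coef_fe beta 1 j = beta j.
Proof.
(* Only $k = j$ contributes, through the convention $\binom{-1}{-1} = 1$. *)
rewrite /coef_fe big_nat_recr //= big_nat big1 => [|k /andP[_ kj]].
  have -> : 1%:Z + j%:Z - 2 - j%:Z = Negz 0 by lia.
  by rewrite add0r mul1r.
have -> : 1%:Z + j%:Z - 2 - k%:Z = Posz (j - k.+1) by lia.
by rewrite mul0r.
Qed.

Lemma coef_feE beta i j :
  coef_fe beta i.+2 j = \sum_(0 <= k < j.+1) 'C(i + j - k, i)%:R * beta k.
Proof.
apply: eq_big_nat => k /andP[_ ki]; congr (_%:R * _).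
have -> : i.+2%:Z + j%:Z - 2 - k%:Z = Posz (i + j - k) by lia.
by have -> : i.+2%:Z - 2 = Posz i by lia.
Qed.

Lemma coef_ef1 beta j : beta 0%N = 1 -> coef_ef beta 1 j.+1 = 1.
Proof. by move=> b0; rewrite coef_efE big_nat1 subn0 binn mul1r. Qed.

(** Pascal's rule.  This recursion and the next one are those that the Zinbiel
    identity imposes on the products $e_i \circ f_j$ and $f_i \circ e_j$, see
    [mul_chains]. *)
Lemma coef_ef_rec beta i j :
  coef_ef beta i.+2 j.+1 = coef_ef beta i.+1 j.+1 + coef_fe beta j.+1 i.+1.
Proof.
case: j => [|j].
  rewrite coef_fe1 !coef_efE big_nat_recr //=; congr (_ + _).
    by apply: eq_big_nat => k _; rewrite !bin0.
  by rewrite bin0 mul1r.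
rewrite coef_feE !coef_efE big_nat_recr //= [in RHS]addrC.
rewrite [in RHS]big_nat_recr //= addrAC -big_split /=; congr (_ + _).
  apply: eq_big_nat => k /andP[_ ki].
  rewrite -mulrDl -natrD; congr (_%:R * _).
  have -> : (i.+1 + j.+1 - k = (i + j - k).+2)%N by lia.
  have -> : (i + j.+1 - k = (i + j - k).+1)%N by lia.
  have -> : (j + i.+1 - k = (i + j - k).+1)%N by lia.
  by rewrite binS addnC.
have -> : (i.+1 + j.+1 - i.+1 = j.+1)%N by lia.
have -> : (j + i.+1 - i.+1 = j)%N by lia.
by rewrite !binn.
Qed.

Lemma coef_fe_rec beta i j :
  coef_fe beta i.+2 j.+1 = coef_fe beta i.+1 j.+1 + coef_ef beta j.+1 i.+1.
Proof.
case: i => [|i].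
  rewrite coef_fe1 coef_feE coef_efE big_nat_recr //= addrC; congr (_ + _).
    by rewrite bin0 mul1r.
  by apply: eq_big_nat => k _; rewrite !bin0.
rewrite !coef_feE coef_efE big_nat_recr //= [in RHS]big_nat_recr //=.
rewrite addrAC -big_split /=; congr (_ + _).
  apply: eq_big_nat => k /andP[_ ki].
  rewrite -mulrDl -natrD; congr (_%:R * _).
  have -> : (i.+1 + j.+1 - k = (i + j - k).+2)%N by lia.
  have -> : (i + j.+1 - k = (i + j - k).+1)%N by lia.
  have -> : (j + i.+1 - k = (i + j - k).+1)%N by lia.
  by rewrite binS addnC.
have -> : (i.+1 + j.+1 - j.+1 = i.+1)%N by lia.
have -> : (i + j.+1 - j.+1 = i)%N by lia.
by rewrite !binn.
Qed.

Lemma beta1S b j : j.+1%:R * beta1 b j.+1 = (j%:R + b) * beta1 b j.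
Proof.
by rewrite /beta1 big_nat_recr //= mulrC -mulrA divfK ?pnatr_eq0 // mulrC.
Qed.

Lemma beta1_1 b : beta1 b 1 = b.
Proof. by rewrite /beta1 big_nat1 add0r divr1. Qed.

(** The recursion $j \beta_j = \beta_1 (\beta_0 + \dots + \beta_{j-1})$, in
    the form in which [y_X] meets it. *)
Lemma sum_beta1 b j :
  b * \sum_(0 <= k < j.+1) beta1 b k = j.+1%:R * beta1 b j.+1.
Proof.
elim: j => [|j IHj]; first by rewrite big_nat1 beta1_1 /beta1 big_nil mulr1 mul1r.
by rewrite big_nat_recr //= mulrDr IHj -mulrDl beta1S.
Qed.

Lemma beta1_eq1 j : beta1 (1 : K) j = 1.
Proof.
rewrite /beta1 big1_seq // => k _.
by rewrite natr1 divff // pnatr_eq0.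
Qed.

(** For $b = 2 - p$ the factors $k + b$ are the negatives of the factors
    $p - 2 - k$ of a falling factorial, and both sides vanish for
    $i > p - 2$. *)
Lemma beta2E p i : (2 <= p)%N -> beta2 K p i = beta1 (2 - p%:R) i.
Proof.
move=> p2; elim: i => [|i IHi]; first by rewrite /beta2 /beta1 big_nil bin0 mulr1.
apply: (mulfI (_ : i.+1%:R != 0)); first by rewrite pnatr_eq0.
rewrite beta1S -IHi /beta2 mulrCA -natrM mulnC.
have [ip|pi] := leqP i (p - 2).
  have -> : i%:R + (2 - p%:R) = - (p - 2 - i)%:R :> K.
    by rewrite natrB // natrB //; ring.
  rewrite (_ : 'C(p - 2, i.+1) * i.+1 = (p - 2 - i) * 'C(p - 2, i))%N.
    by rewrite natrM exprS; ring.
  by rewrite mulnC mul_bin_left.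
by rewrite !bin_small ?mul0n ?mulr0 //; lia.
Qed.

End StructureConstants.

(** * Products of chains in a Zinbiel algebra *)

Section Chains.
Variables (K : numFieldType) (V : vectType K) (mul : {bilinear V -> V -> V}).
Hypothesis zin : zinbiel mul.
Local Notation "x ** y" := (mul x y) (at level 40, left associativity).
Implicit Types (x y u v w : V) (a b c : K).

(** Indices start at $0$: $e_{i+1}$ is [chain e_1 e_1 i] and $f_{i+1}$ is
    [chain e_1 f_1 i]. *)
Definition chain x u (i : nat) : V := iter i (mul x) u.
Arguments chain : simpl never.

Lemma chainS x u i : chain x u i.+1 = x ** chain x u i.
Proof. by []. Qed.

Lemma chainD x u i j : chain x u (i + j) = chain x (chain x u j) i.
Proof. exact: iterD. Qed.

Lemma chainZ x a u i : chain x (a *: u) i = a *: chain x u i.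
Proof. by elim: i => // i; rewrite /chain /= => ->; rewrite linearZr_LR. Qed.

Lemma chain_eq0 x u i j : (i <= j)%N -> chain x u i = 0 -> chain x u j = 0.
Proof.
move=> /subnK <- ui0; rewrite chainD ui0.
by elim: (j - i)%N => // l; rewrite /chain /= => ->; rewrite linear0r.
Qed.

(** The Zinbiel identity says that $(x \circ u) \circ v$ is $x$ applied to the
    symmetrized product of $u$ and $v$; so products of chains satisfy a Pascal
    recursion, and they are determined by the products of the two heads.  The
    recursion of the coefficients is required only against the vectors
    themselves, since these vanish beyond the end of the chain. *)
Lemma mul_chains x u v w (P Q : nat -> nat -> K) :
    (forall j, u ** chain x v j = P 0%N j *: chain x w j.+1) ->
    (forall j, v ** chain x u j = Q 0%N j *: chain x w j.+1) ->
    (forall i j, (P i j + Q j i) *: chain x w (i + j).+2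
                   = P i.+1 j *: chain x w (i + j).+2) ->
    (forall i j, (Q i j + P j i) *: chain x w (i + j).+2
                   = Q i.+1 j *: chain x w (i + j).+2) ->
  forall i j, chain x u i ** chain x v j = P i j *: chain x w (i + j).+1
           /\ chain x v i ** chain x u j = Q i j *: chain x w (i + j).+1.
Proof.
move=> uv vu recP recQ i j; move En: (i + j)%N => n.
elim: n i j En => [|n IHn] [|i] j En.
- by move: En; rewrite add0n => ->; split; [apply: uv | apply: vu].
- by [].
- by move: En; rewrite add0n => ->; split; [apply: uv | apply: vu].
have {}En : (i + j = n)%N by lia.
have [uv_ij vu_ij] := IHn _ _ En.
have [] := IHn j i; rewrite 1?addnC // => uv_ji vu_ji.
rewrite !chainS !zin uv_ij vu_ij uv_ji vu_ji !linearZr_LR /= -!chainS.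
by rewrite -!scalerDl -En recP recQ.
Qed.

Lemma mul_chain x u w (P : nat -> nat -> K) :
    (forall j, u ** chain x u j = P 0%N j *: chain x w j.+1) ->
    (forall i j, (P i j + P j i) *: chain x w (i + j).+2
                   = P i.+1 j *: chain x w (i + j).+2) ->
  forall i j, chain x u i ** chain x u j = P i j *: chain x w (i + j).+1.
Proof. by move=> uu rec i j; have [] := mul_chains uu uu rec rec i j. Qed.

Lemma binom_rec (i j : nat) :
  'C((i + j).+1, j.+1)%:R + 'C((j + i).+1, i.+1)%:R
    = 'C((i + j).+2, j.+1)%:R :> K.
Proof.
rewrite -natrD [in RHS]binS; congr ((_ + _)%:R).
by rewrite addnC -bin_sub; [congr 'C(_, _)|]; lia.
Qed.

Lemma mul_chain_self x i j :
  chain x x i ** chain x x j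
    = 'C((i + j).+1, j.+1)%:R *: chain x x (i + j).+1.
Proof.
apply: (mul_chain (P := fun i j => 'C((i + j).+1, j.+1)%:R)) => [k|k l].
  by rewrite add0n binn scale1r.
by rewrite binom_rec.
Qed.

End Chains.
Arguments chain : simpl never.

(** * Algebras generated by two homogeneous elements *)

Section AdaptedPair.
Variables (K : numFieldType) (V : vectType K) (mul : {bilinear V -> V -> V}).
Hypothesis zin : zinbiel mul.
Local Notation "x ** y" := (mul x y) (at level 40, left associativity).
Implicit Types (x y u v w : V) (a b c : K).

(** Type I for elements $e_1 = x$ and $f_1 = y$ of degree $1$ in a graded
    algebra.  The last two clauses record the grading: a product of degree $l$
    is a combination of $e_l$ and $f_l$. *)
Definition adapted (m p : nat) x y : Prop :=
  [/\ basis_of fullv ([seq chain mul x x i | i <- iota 0 m]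
                      ++ [seq chain mul x y i | i <- iota 0 p]),
      chain mul x x m = 0,
      chain mul x y p = 0,
      exists a b, y ** x = a *: chain mul x x 1 + b *: chain mul x y 1
    & forall l, exists a b,
        y ** chain mul x y l
          = a *: chain mul x x l.+1 + b *: chain mul x y l.+1].

Variables (m p : nat) (x y : V).
Hypotheses (p3 : (3 <= p)%N) (pm : (p + 2 <= m)%N).
Hypothesis xy_adapted : adapted m p x y.
Local Notation X := (chain mul x x).
Local Notation Y := (chain mul x y).

Lemma adapted_X0 i : (m <= i)%N -> X i = 0.
Proof. by move=> mi; case: xy_adapted => _ X0 _ _ _; apply: chain_eq0 X0. Qed.

Lemma adapted_Y0 i : (p <= i)%N -> Y i = 0.
Proof. by move=> mi; case: xy_adapted => _ _ Y0 _ _; apply: chain_eq0 Y0. Qed.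

Lemma adapted_indep j a c : a *: X j + c *: Y j = 0 ->
  ((j < m)%N -> a = 0) /\ ((j < p)%N -> c = 0).
Proof.
move=> XY0; case: xy_adapted => /basis_free.
rewrite cat_free => /and3P[freeX freeY /directv_addP capXY] _ _ _ _.
have spX : (j < m)%N -> X j \in <<[seq X i | i <- iota 0 m]>>%VS.
  by move=> jm; rewrite memv_span // map_f // mem_iota.
have spY : (j < p)%N -> Y j \in <<[seq Y i | i <- iota 0 p]>>%VS.
  by move=> jp; rewrite memv_span // map_f // mem_iota.
have Xj0 : (j < m)%N -> X j != 0.
  by move=> jm; rewrite (free_not0 freeX) // map_f // mem_iota.
have Yj0 : (j < p)%N -> Y j != 0.
  by move=> jp; rewrite (free_not0 freeY) // map_f // mem_iota.
have [jm|mj] := ltnP j m; last by split=> // jp; lia.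
have Xa0 : a *: X j = 0.
  have [jp|pj] := ltnP j p; last by rewrite adapted_Y0 // scaler0 addr0 in XY0.
  apply/eqP; rewrite -memv0 -capXY memv_cap memvZ ?spX //=.
  by rewrite (eqP (_ : a *: X j == - (c *: Y j))) ?memvN ?memvZ ?spY // -addr_eq0 XY0.
split=> [_|jp].
  by apply/eqP; move/eqP: Xa0; rewrite scaler_eq0 (negPf (Xj0 jm)) orbF.
by apply/eqP; move/eqP: XY0; rewrite Xa0 add0r scaler_eq0 (negPf (Yj0 jp)) orbF.
Qed.

(** Right multiplication by $e_1$ is computed along the chain of $f_1$; past
    the end of that chain it produces a multiple of $e_{p+2} \ne 0$, and so
    $f_1 \circ e_1$ has no component along $e_2$. *)
Lemma adapted_yx : exists b, y ** x = b *: Y 1.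
Proof.
case: xy_adapted => _ _ _ [a [b yx]] _; exists b.
have symYx l : Y l ** x + x ** Y l = (l.+1%:R + b) *: Y l.+1 + a *: X l.+1.
  elim: l => [|l IHl].
    by rewrite yx [X in _ + X](_ : _ = Y 1) // scalerDl scale1r addrC [RHS]addrAC addrA.
  rewrite chainS zin -linearDr IHl linearDr !linearZr_LR /= -!chainS.
  by rewrite -[l.+2%:R]natr1 -[_ + 1 + b]addrAC [in RHS]scalerDl scale1r addrAC.
have := symYx p; rewrite (adapted_Y0 (leqnn p)) (adapted_Y0 (leqnSn p)).
rewrite (linear0l mul x) linear0r scaler0 addr0 add0r.
move=> aX0; rewrite yx (_ : a = 0) ?scale0r ?add0r //.
by have [|a0 _] := @adapted_indep p.+1 a 0; [rewrite scale0r addr0|apply: a0; lia].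
Qed.

Section Heads.
Variable b : K.
Hypothesis yx : y ** x = b *: Y 1.

Lemma sym_Yx l : Y l ** x + x ** Y l = (l.+1%:R + b) *: Y l.+1.
Proof.
elim: l => [|l IHl]; first by rewrite yx scalerDl scale1r addrC.
rewrite chainS zin -linearDr IHl linearZr_LR /= -!chainS.
by rewrite -[l.+2%:R]natr1 -[_ + 1 + b]addrAC [in RHS]scalerDl scale1r.
Qed.

Lemma YS_x l : Y l.+1 ** x = (l.+1%:R + b) *: Y l.+2.
Proof. by rewrite chainS zin -linearDr sym_Yx linearZr_LR. Qed.

Lemma X_x l : X l ** x = l.+1%:R *: X l.+1.
Proof. by have := mul_chain_self zin x l 0; rewrite /= addn0 bin1. Qed.

(** The values $\beta_j$ follow from
    $(f_1 \circ e_1) \circ e_j = f_1 \circ (e_1 \circ e_j + e_j \circ e_1)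
    = (j + 1) f_1 \circ e_{j+1}$, by induction together with
    $e_j \circ f_1 = (\beta_0 + \dots + \beta_{j-1}) f_{j+1}$. *)
Lemma y_X j : y ** X j = beta1 b j.+1 *: Y j.+1.
Proof.
suff: y ** X j = beta1 b j.+1 *: Y j.+1
   /\ X j ** y = (\sum_(0 <= k < j.+1) beta1 b k) *: Y j.+1 by case.
elim: j => [|j [yX Xy]].
  by rewrite big_nat1 beta1_1 /beta1 big_nil scale1r.
split; last first.
  rewrite chainS zin -linearDr yX Xy -scalerDl linearZr_LR.
  by rewrite [in RHS]big_nat_recr.
have := zin y x (X j); rewrite -linearDr X_x -chainS.
rewrite -[X in X + _]scale1r -scalerDl linearZr_LR yx linearZl_LR /= zin -linearDr.
rewrite yX Xy -scalerDl linearZr_LR /= scalerA addrC -big_nat_recr //= sum_beta1.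
rewrite nat1r -chainS -scalerA => /(scalerI _) ->//; by rewrite pnatr_eq0.
Qed.

(** Expanding $(f_1 \circ e_1) \circ f_l$ in two ways gives $f_1 \circ f_{l+1}$
    unless $l + b = 0$. *)
Lemma y_YS l :
  (l.+1%:R + b) *: (y ** Y l.+1) = b *: (x ** (y ** Y l + Y l ** y)).
Proof.
by rewrite -linearZr_LR -sym_Yx [in LHS]addrC linearDr -zin yx linearZl_LR /=
           zin linearDr.
Qed.

(** Both $(f_1 \circ f_1) \circ e_1$ and $(f_1 \circ e_1) \circ f_1$ are equal
    to $f_1 \circ (f_1 \circ e_1 + e_1 \circ f_1)$; the comparison of their
    coefficients along $e_3$ and $f_3$ produces the factor $b - 1$.  Note
    that $f_3 \ne 0$, as $p \ge 3$. *)
Lemma y_y : exists a c, [/\ y ** y = a *: X 1 + c *: Y 1, (b - 1) * a = 0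
                           & (b - 1) * c = 0].
Proof.
case: xy_adapted => _ _ _ _ /(_ 0%N) [a [c yy]]; exists a, c.
have : (y ** y) ** x - (y ** x) ** y = 0.
  by rewrite !zin [X in _ - X]addrC subrr.
rewrite {1}[y ** y]yy yx linearDl !linearZl_LR /= X_x YS_x zin.
rewrite -mulr2n yy linearDr !linearZr_LR /= -!chainS -scaler_nat.
rewrite !scalerDr !scalerA opprD addrACA -!scalerBl => /adapted_indep[a0 c0].
split=> //.
  apply: (mulfI (_ : 2%:R != 0)); first by rewrite pnatr_eq0.
  by rewrite mulr0 -[LHS]opprK -[RHS]oppr0 -(a0 ltac:(lia)); ring.
by rewrite -[LHS]opprK -[RHS]oppr0 -(c0 ltac:(lia)); ring.
Qed.

(** The degenerate step $b = -k$ of the recursion [y_YS], which leaves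
    $f_1 \circ f_{k+1}$ undetermined.  Multiplying by $e_1$ on the right and
    expanding $(f_1 \circ e_1) \circ f_{k+1}$ give two values of
    $f_1 \circ f_{k+2}$, and the comparison kills every coefficient that does
    not multiply the last vector $f_p$. *)
Lemma y_Y_degenerate k : (0 < k)%N -> (k < p)%N -> k%:R + b = 0 ->
  Y k ** y = 0 ->
  exists2 c, y ** Y k = c *: Y k.+1 & (k.+2 < p)%N -> c = 0.
Proof.
move=> k0 kp kb Yky; case: xy_adapted => _ _ _ _ /(_ k) [a [c yYk]].
have kb1 : k.+1%:R + b = 1 by rewrite -nat1r -addrA kb addr0.
have eq1 : (y ** Y k) ** x = y ** Y k.+1.
  by rewrite zin -linearDr sym_Yx kb1 scale1r.
have eq2 : y ** Y k.+1 = b *: (x ** (y ** Y k)).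
  by have := y_YS k; rewrite kb1 scale1r Yky addr0.
move: eq1; rewrite eq2 yYk linearDl linearDr !linearZl_LR !linearZr_LR /=.
rewrite X_x YS_x kb1 -!chainS scale1r scalerDr !scalerA => /eqP.
rewrite -subr_eq0 opprD addrACA -!scalerBl => /eqP /adapted_indep[a0 c0].
have bE : b = - k%:R by apply/eqP; rewrite -addr_eq0 addrC kb.
exists c.
  suff -> : a = 0 by rewrite scale0r add0r.
  apply: (mulfI (_ : (k.+2 + k)%:R != 0)); first by rewrite pnatr_eq0.
  by rewrite mulr0 -(a0 ltac:(lia)) bE natrD; ring.
move=> kp2; apply: (mulfI (_ : k.+1%:R != 0)); first by rewrite pnatr_eq0.
by rewrite mulr0 -(c0 kp2) bE -nat1r; ring.
Qed.

(** For $b \ne 1$ one has $f_1 \circ f_1 = 0$, and [y_YS] propagates this along the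
    chain, except at a degenerate step.  Only the last of these can give a
    nonzero product. *)
Lemma y_Y_neq1 : b != 1 ->
  exists2 c, c != 0 -> b = 2 - p%:R
    & forall l, y ** Y l = (if l == (p - 2)%N then c else 0) *: Y l.+1.
Proof.
move=> b1; have [a [c [yy ba bc]]] := y_y.
have {ba bc} yy0 : y ** y = 0.
  move: ba bc => /eqP + /eqP; rewrite !mulf_eq0 !subr_eq0 (negPf b1) /=.
  by move=> /eqP a0 /eqP c0; rewrite yy a0 c0 !scale0r addr0.
have step k : y ** Y k = 0 -> Y k ** y = 0 ->
    Y k.+1 ** y = 0 /\ (k.+1%:R + b) *: (y ** Y k.+1) = 0.
  move=> yY Yy; rewrite y_YS chainS zin -linearDr yY Yy addr0 linear0r.
  by rewrite scaler0.
have below k : (k < p - 2)%N -> y ** Y k = 0 /\ Y k ** y = 0.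
  elim: k => [|k IHk] kp; first by rewrite /chain /= yy0.
  have [yY Yy] := IHk ltac:(lia); have [YSy /eqP] := step k yY Yy.
  rewrite scaler_eq0 => /orP[/eqP kb|/eqP-> //].
  have [d -> d0] := @y_Y_degenerate k.+1 isT ltac:(lia) kb YSy.
  by rewrite d0 ?scale0r //; lia.
have [yYp Yyp] := below (p - 3)%N ltac:(lia).
have [] := step _ yYp Yyp; rewrite (_ : (p - 3).+1 = p - 2)%N; last by lia.
move=> Yy /eqP; rewrite scaler_eq0 => pb.
have [d yY dpb] : exists2 d, y ** Y (p - 2)%N = d *: Y (p - 2).+1
                           & d != 0 -> (p - 2)%:R + b = 0.
  have [pb0|bp] := eqVneq ((p - 2)%:R + b) 0; last first.
    by move: pb; rewrite (negPf bp) /= => /eqP->; exists 0; rewrite ?scale0r ?eqxx.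
  by have [d -> _] := @y_Y_degenerate (p - 2)%N ltac:(lia) ltac:(lia) pb0 Yy; exists d.
exists d => [/dpb|l].
  by rewrite (natrB _ (ltnW p3)) => /eqP; rewrite addrC addr_eq0 opprB => /eqP.
have [->|lp2] := eqVneq l (p - 2)%N; first by rewrite yY; congr (_ *: Y _); lia.
rewrite scale0r; have [lp|lp|lE] := ltngtP l (p - 1)%N.
- by have [] := below l ltac:(lia).
- by rewrite adapted_Y0 ?linear0r //; lia.
have Sp2 : (p - 2).+1 = l by lia.
have Yly : Y l ** y = 0.
  rewrite -Sp2 chainS zin -linearDr yY Yy add0r linearZr_LR /= -chainS.
  by rewrite adapted_Y0 ?scaler0 //; lia.
have /eqP := y_YS (p - 2)%N.
rewrite yY Yy addr0 linearZr_LR /= -chainS [Y (p - 2).+2]adapted_Y0; last by lia.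
rewrite !scaler0 Sp2 scaler_eq0 => /orP[/eqP lb|/eqP //].
have [e -> _] := @y_Y_degenerate l ltac:(lia) ltac:(lia) lb Yly.
by rewrite adapted_Y0 ?scaler0 //; lia.
Qed.

(** For $b = 1$ the elements $f_1 \circ f_l$ are the chain of $f_1 \circ f_1$,
    and $f_1 \circ f_{p+1} = 0$ excludes a component of $f_1 \circ f_1$ along
    $e_2$. *)
Lemma y_Y_eq1 : b = 1 -> exists c, forall l, y ** Y l = c *: Y l.+1.
Proof.
move=> b1; have [a [c [yy _ _]]] := y_y; exists c.
pose Z l := a *: X l.+1 + c *: Y l.+1.
have xZ l : x ** Z l = Z l.+1 by rewrite linearDr !linearZr_LR.
have YZ l : y ** Y l = Z l /\ Y l ** y = l.+1%:R *: Z l.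
  elim: l => [|l [yYl Yly]]; first by rewrite scale1r.
  split; last first.
    by rewrite chainS zin -linearDr yYl Yly -[X in _ + X]scale1r -scalerDl
               linearZr_LR /= xZ natr1.
  apply: (scalerI (_ : l.+2%:R != 0)); first by rewrite pnatr_eq0.
  have := y_YS l; rewrite b1 natr1 scale1r => ->.
  by rewrite yYl Yly -[X in X + _]scale1r -scalerDl linearZr_LR /= xZ nat1r.
suff a0 : a = 0 by move=> l; have [-> _] := YZ l; rewrite /Z a0 scale0r add0r.
have [+ _] := YZ p; rewrite adapted_Y0 // linear0r => /esym/adapted_indep[a0 _].
by apply: a0; lia.
Qed.

End Heads.
End AdaptedPair.

(** * Recognizing an algebra from its multiplication table *)

Section Recognition.
Variables (K : numFieldType) (V : vectType K) (mul : {bilinear V -> V -> V}).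
Variables (m p : nat) (e f : nat -> V).
Hypothesis ef_basis :
  basis_of fullv ([seq e i | i <- iota 0 m] ++ [seq f i | i <- iota 0 p]).
Hypotheses (e0 : forall i, (m <= i)%N -> e i = 0)
           (f0 : forall i, (p <= i)%N -> f i = 0).

Let bs := [seq e i | i <- iota 0 m] ++ [seq f i | i <- iota 0 p].

Fact size_bs : size bs == (m + p)%N.
Proof. by rewrite size_cat !size_map !size_iota. Qed.

Let bt : (m + p).-tuple V := Tuple size_bs.

Definition from_coords (r : 'rV[K]_(m + p)) : V := \sum_l r 0 l *: bt`_l.

Fact from_coords_linear : linear from_coords.
Proof.
move=> a r s; rewrite /from_coords scaler_sumr -big_split /=.
by apply: eq_bigr => l _; rewrite !mxE scalerDl scalerA.
Qed.
HB.instance Definition _ :=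
  GRing.isLinear.Build K 'rV[K]_(m + p) V _ from_coords from_coords_linear.

Definition to_coords (v : V) : 'rV[K]_(m + p) := \row_l coord bt l v.

Fact to_coords_linear : linear to_coords.
Proof. by move=> a u v; apply/rowP=> l; rewrite !mxE linearP. Qed.
HB.instance Definition _ :=
  GRing.isLinear.Build K V 'rV[K]_(m + p) _ to_coords to_coords_linear.

Fact to_coordsK : cancel to_coords from_coords.
Proof.
move=> v; rewrite [RHS](coord_basis (X := bt) ef_basis (memvf v)).
by apply: eq_bigr => l _; rewrite mxE.
Qed.

Fact from_coordsK : cancel from_coords to_coords.
Proof.
move=> r; apply/rowP=> l; rewrite mxE coord_sum_free //.
exact: basis_free ef_basis.
Qed.

Fact from_coords_delta l : from_coords (delta_mx 0 l) = bs`_l.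
Proof.
rewrite /from_coords (bigD1 l) //= mxE !eqxx scale1r big1 ?addr0 // => i il.
by rewrite mxE (negPf il) scale0r.
Qed.

Fact from_coords_evec i : from_coords (evec K m p i.+1) = e i.
Proof.
have [im|mi] := ltnP i m.
  rewrite (evecE _ _ (Ordinal im)) from_coords_delta nth_cat size_map size_iota /=.
  by rewrite im (nth_map 0%N) ?size_iota // nth_iota.
rewrite e0 // (_ : evec K m p _ = 0) ?linear0 //.
by apply/rowP=> l; rewrite !mxE /= ltnNge mi.
Qed.

Fact from_coords_fvec i : from_coords (fvec K m p i.+1) = f i.
Proof.
have [ip|pi] := ltnP i p.
  rewrite (fvecE _ _ (Ordinal ip)) from_coords_delta nth_cat size_map size_iota /=.
  by rewrite ltnNge leq_addr /= addKn (nth_map 0%N) ?size_iota // nth_iota.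
rewrite f0 // (_ : fvec K m p _ = 0) ?linear0 //.
by apply/rowP=> l; rewrite !mxE /= ltnNge pi.
Qed.

Variables (ee ef fe ff : nat -> nat -> 'rV[K]_(m + p)).
Hypotheses
  (mul_ee : forall i j, (i < m)%N -> (j < m)%N ->
     mul (e i) (e j) = from_coords (ee i.+1 j.+1))
  (mul_ef : forall i j, (i < m)%N -> (j < p)%N ->
     mul (e i) (f j) = from_coords (ef i.+1 j.+1))
  (mul_fe : forall i j, (i < p)%N -> (j < m)%N ->
     mul (f i) (e j) = from_coords (fe i.+1 j.+1))
  (mul_ff : forall i j, (i < p)%N -> (j < p)%N ->
     mul (f i) (f j) = from_coords (ff i.+1 j.+1)).

Lemma alg_iso_table : alg_iso mul (table_mul ee ef fe ff).
Proof.
exists to_coords; split; first by exists from_coords;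
  [apply: to_coordsK | apply: from_coordsK].
have bs_l (i : 'I_m) : bs`_(lshift p i) = e i.
  rewrite /bs nth_cat size_map size_iota /= ltn_ord.
  by rewrite (nth_map 0%N) ?size_iota // nth_iota.
have bs_r (i : 'I_p) : bs`_(rshift m i) = f i.
  rewrite /bs nth_cat size_map size_iota /= ltnNge leq_addr /= addKn.
  by rewrite (nth_map 0%N) ?size_iota // nth_iota.
have tabE k l : from_coords (table ee ef fe ff k l) = mul bs`_k bs`_l.
  rewrite -(splitK k) -(splitK l) /table !unsplitK.
  by case: (split k) (split l) => i [] j /=; rewrite ?bs_l ?bs_r;
    [rewrite mul_ee | rewrite mul_ef | rewrite mul_fe | rewrite mul_ff].
move=> u v; apply: (can_inj from_coordsK); rewrite to_coordsK.
rewrite -{1}[u]to_coordsK -{1}[v]to_coordsK [RHS]linear_sum.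
rewrite {1}/from_coords linear_sumlz; apply: eq_bigr => k _.
rewrite linearZl_LR /= linear_sumr scaler_sumr linear_sum; apply: eq_bigr => l _.
by rewrite linearZr_LR scalerA [RHS]linearZ /= tabE.
Qed.

End Recognition.

(** * The three families *)

Section Classification.
Variables (K : numFieldType) (V : vectType K) (mul : {bilinear V -> V -> V}).
Hypothesis zin : zinbiel mul.
Variables (m p : nat).
Hypotheses (p3 : (3 <= p)%N) (pm : (p + 2 <= m)%N).
Local Notation "x ** y" := (mul x y) (at level 40, left associativity).
Implicit Types (x y u v w : V) (a b c : K).

Lemma adapted_scale x y c : c != 0 -> adapted mul m p x y ->
  adapted mul m p x (c *: y).
Proof.
move=> c0 [bXY Xm Yp [a [b yx]] yY]; split=> //.
- rewrite basisEdim size_cat !size_map !size_iota.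
  move: bXY; rewrite basisEdim size_cat !size_map !size_iota.
  move=> /andP[spXY ->]; rewrite andbT.
  apply: subv_trans spXY _; rewrite !span_cat; apply: addvS => //.
  apply/span_subvP => _ /mapP[i ip ->].
  rewrite -[chain mul x y i](scalerK c0) -chainZ memvZ // memv_span //.
  exact: map_f.
- by rewrite chainZ Yp scaler0.
- exists (c * a), b; rewrite linearZl_LR /= yx chainZ scalerDr !scalerA.
  by rewrite [c * b]mulrC.
- move=> l; have [a' [b' yYl]] := yY l; exists (c * c * a'), (c * b').
  rewrite !chainZ linearZl_LR linearZr_LR /= yYl !scalerDr !scalerA.
  by rewrite [c * b' * c]mulrAC.
Qed.

Section Tables.
Variables (x y : V).
Hypothesis xy_adapted : adapted mul m p x y.
Local Notation X := (chain mul x x).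
Local Notation Y := (chain mul x y).
Local Notation fc := (@from_coords K V m p X Y).

Lemma from_coords_scale_evec i j c : 
  fc (if (i.+1 + j.+1 <= m)%N then c *: evec K m p (i.+1 + j.+1) else 0)
    = c *: X (i + j).+1.
Proof.
case: xy_adapted => bXY _ _ _ _; rewrite addSn addnS.
case: ifPn => [_|mi].
  rewrite linearZ /= from_coords_evec // => k; exact: (adapted_X0 xy_adapted).
by rewrite linear0 (adapted_X0 xy_adapted) ?scaler0 //; lia.
Qed.

Lemma from_coords_scale_fvec i j c :
  fc (if (i.+1 + j.+1 <= p)%N then c *: fvec K m p (i.+1 + j.+1) else 0)
    = c *: Y (i + j).+1.
Proof.
case: xy_adapted => bXY _ _ _ _; rewrite addSn addnS.
case: ifPn => [_|mi].
  rewrite linearZ /= from_coords_fvec // => k; exact: (adapted_Y0 xy_adapted).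
by rewrite linear0 (adapted_Y0 xy_adapted) ?scaler0 //; lia.
Qed.

Lemma mul_ee_tab i j : X i ** X j = fc (tab_ee K m p i.+1 j.+1).
Proof.
by rewrite from_coords_scale_evec mul_chain_self // addSn addnS subn1.
Qed.

(** The products of the $e_i$ with the $f_j$ are governed by the values
    $\beta_j$ in $f_1 \circ e_j = \beta_j f_{j+1}$. *)
Lemma mul_ef_tab (beta : nat -> K) : beta 0%N = 1 ->
    (forall j, y ** X j = beta j.+1 *: Y j.+1) ->
  forall i j, X i ** Y j = fc (tab_ef m p beta i.+1 j.+1)
           /\ Y j ** X i = fc (tab_fe m p beta j.+1 i.+1).
Proof.
move=> b0 yX i j; rewrite !from_coords_scale_fvec.
have XY k l : X k ** Y l = coef_ef beta k.+1 l.+1 *: Y (k + l).+1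
           /\ Y k ** X l = coef_fe beta k.+1 l.+1 *: Y (k + l).+1.
  apply: (mul_chains (P := fun k l => coef_ef beta k.+1 l.+1)
            (Q := fun k l => coef_fe beta k.+1 l.+1) zin) => {k l} [k|k|k l|k l].
  - by rewrite coef_ef1 // scale1r.
  - by rewrite coef_fe1.
  - by rewrite [coef_ef _ k.+2 _]coef_ef_rec.
  - by rewrite [coef_fe _ k.+2 _]coef_fe_rec.
by split; [have [] := XY i j | have [] := XY j i].
Qed.

(** A single product $f_1 \circ f_{p-1} = c f_p$ does not propagate along the
    chains, since $e_1 \circ f_p = 0$. *)
Lemma mul_ff_last c :
    (forall l, y ** Y l = (if l == (p - 2)%N then c else 0) *: Y l.+1) ->
  forall i j, Y i ** Y j = (if (i == 0)%N && (j == (p - 2)%N) then c else 0)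
                             *: Y (i + j).+1.
Proof.
move=> yY; apply: (mul_chain zin) => // i j /=.
rewrite scale0r; case: (leqP p (i + j).+2) => [pij|ijp].
  by rewrite (adapted_Y0 xy_adapted) ?scaler0.
by rewrite !ifN ?addr0 ?scale0r //; apply/negP=> /andP[/eqP i0 /eqP jp]; lia.
Qed.

Lemma adapted_A1 b : (forall j, y ** X j = beta1 b j.+1 *: Y j.+1) ->
    (forall l, y ** Y l = 0) ->
  alg_iso mul (algA1 m p b).
Proof.
move=> yX yY; have b0 : beta1 b 0 = 1 by rewrite /beta1 big_nil.
case: (xy_adapted) => bXY _ _ _ _.
have YY i j : Y i ** Y j = 0.
  have yY0 l : y ** Y l = (if l == (p - 2)%N then 0 else 0) *: Y l.+1.
    by rewrite yY if_same scale0r.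
  by rewrite (mul_ff_last yY0) if_same scale0r.
apply: (alg_iso_table bXY) => [i j _ _|i j _ _|i j _ _|i j _ _].
- exact: mul_ee_tab.
- by have [] := mul_ef_tab b0 yX i j.
- by have [] := mul_ef_tab b0 yX j i.
- by rewrite YY linear0.
Qed.

Lemma adapted_A2 : (forall j, y ** X j = beta2 K p j.+1 *: Y j.+1) ->
    (forall l, y ** Y l = (if l == (p - 2)%N then 1 else 0) *: Y l.+1) ->
  alg_iso mul (algA2 K m p).
Proof.
move=> yX yY; have b0 : beta2 K p 0 = 1 by rewrite /beta2 bin0 mulr1.
case: (xy_adapted) => bXY _ _ _ _.
apply: (alg_iso_table bXY) => [i j _ _|i j _ _|i j _ _|i j _ _].
- exact: mul_ee_tab.
- by have [] := mul_ef_tab b0 yX i j.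
- by have [] := mul_ef_tab b0 yX j i.
rewrite (mul_ff_last yY) eqSS (_ : (j.+1 == p - 1) = (j == p - 2))%N; last by lia.
case: ifP => [/andP[/eqP-> /eqP->]|_]; last by rewrite linear0 scale0r.
rewrite (_ : fvec K m p p = fvec K m p (p - 1).+1); last by congr fvec; lia.
rewrite from_coords_fvec ?scale1r; last exact: (adapted_Y0 xy_adapted).
by congr chain; lia.
Qed.

Lemma adapted_A3 : (forall j, y ** X j = Y j.+1) ->
    (forall l, y ** Y l = Y l.+1) ->
  alg_iso mul (algA3 K m p).
Proof.
move=> yX yY; case: (xy_adapted) => bXY _ _ _ _.
pose C i j : K := 'C((i + j).+1, j.+1)%:R.
have XY i j : X i ** Y j = C i j *: Y (i + j).+1
           /\ Y i ** X j = C i j *: Y (i + j).+1.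
  apply: (mul_chains zin) => [k|k|k l|k l]; rewrite ?binom_rec //.
    by rewrite /C add0n binn scale1r.
  by rewrite /C add0n binn scale1r yX.
have YY i j : Y i ** Y j = C i j *: Y (i + j).+1.
  apply: (mul_chain zin) => [k|k l]; rewrite ?binom_rec //.
  by rewrite /C add0n binn scale1r yY.
have CE i j : fc (tab_f K m p i.+1 j.+1) = C i j *: Y (i + j).+1.
  by rewrite from_coords_scale_fvec /C addSn addnS subn1.
apply: (alg_iso_table bXY) => [i j _ _|i j _ _|i j _ _|i j _ _].
- exact: mul_ee_tab.
- by rewrite CE; have [] := XY i j.
- by rewrite CE; have [] := XY i j.
- by rewrite CE YY.
Qed.

End Tables.
(** Rescaling $f_1$ normalizes the remaining constant $c$ to $0$ or $1$. *)
Theorem adapted_classification x y : adapted mul m p x y ->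
  [\/ exists b : K, alg_iso mul (algA1 m p b),
      alg_iso mul (algA2 K m p)
    | alg_iso mul (algA3 K m p)].
Proof.
move=> xy; have [b yx] := adapted_yx zin p3 pm xy.
have yX := y_X zin yx.
have [b1|b1] := eqVneq b 1.
  have [c yY] := y_Y_eq1 zin p3 pm xy yx b1.
  have [c0|c0] := eqVneq c 0.
    apply: Or31; exists b; apply: (adapted_A1 xy yX) => l.
    by rewrite yY c0 scale0r.
  apply: Or33; apply: (adapted_A3 (adapted_scale (_ : c^-1 != 0) xy)) => [|j|l].
  - by rewrite invr_eq0.
  - by rewrite linearZl_LR /= yX b1 beta1_eq1 scale1r chainZ.
  - rewrite !chainZ linearZl_LR linearZr_LR /= yY !scalerA.
    by rewrite -mulrA mulVf ?mulr1.
have [c cb yY] := y_Y_neq1 zin p3 pm xy yx b1.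
have [c0|c0] := eqVneq c 0.
  apply: Or31; exists b; apply: (adapted_A1 xy yX) => l.
  by rewrite yY c0 if_same scale0r.
apply: Or32; apply: (adapted_A2 (adapted_scale (_ : c^-1 != 0) xy)) => [|j|l].
- by rewrite invr_eq0.
- by rewrite linearZl_LR /= yX cb // -beta2E ?(ltnW p3) // chainZ scalerA mulrC -scalerA.
- rewrite !chainZ linearZl_LR linearZr_LR /= yY !scalerA; case: ifP => _.
    by rewrite -mulrA mulVf ?mulr1 ?mul1r.
  by rewrite !mulr0 mul0r.
Qed.

End Classification.

(** * Pairwise non-isomorphism *)

Section Degrees.
Variables (K : numFieldType) (m p : nat).
Local Notation V := 'rV[K]_(m + p).
Local Notation ev := (evec K m p).
Local Notation fv := (fvec K m p).
Implicit Types (v w : V) (l : 'I_(m + p)).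

Definition degree l : nat :=
  match split l with inl i => i.+1 | inr j => j.+1 end.

Definition deg_ge (k : nat) v : Prop := forall l, (degree l < k)%N -> v 0 l = 0.

(** Leading terms in degree $k$.  They are multiplicative ([leadM]), and so an
    isomorphism can be studied through its leading terms only. *)
Definition lead (k : nat) v (a c : K) : Prop :=
  deg_ge k.+1 (v - (a *: ev k + c *: fv k)).

Lemma degree_gt0 l : (0 < degree l)%N.
Proof. by rewrite /degree; case: split. Qed.

Lemma evec_degree k l : degree l != k -> ev k 0 l = 0.
Proof.
rewrite /degree mxE; case: splitP => i -> ik; case: eqP => [E|]; rewrite ?andbF //;
  by rewrite [(_ <= _ <= _)%N](_ : _ = false) //; apply/negP => /andP[]; lia.
Qed.

Lemma fvec_degree k l : degree l != k -> fv k 0 l = 0.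
Proof.
rewrite /degree mxE; case: splitP => i -> ik; case: eqP => [E|]; rewrite ?andbF //;
  by rewrite [(_ <= _ <= _)%N](_ : _ = false) //; apply/negP => /andP[];
     have := ltn_ord i; lia.
Qed.

Lemma deg_ge0 k : deg_ge k 0.
Proof. by move=> l _; rewrite mxE. Qed.

Lemma deg_geD k v w : deg_ge k v -> deg_ge k w -> deg_ge k (v + w).
Proof. by move=> kv kw l lk; rewrite mxE kv // kw // addr0. Qed.

Lemma deg_geZ k a v : deg_ge k v -> deg_ge k (a *: v).
Proof. by move=> kv l lk; rewrite mxE kv // mulr0. Qed.

Lemma deg_ge_le k j v : (j <= k)%N -> deg_ge k v -> deg_ge j v.
Proof. by move=> jk kv l lj; apply: kv; apply: leq_trans jk. Qed.

Lemma deg_ge_sum k (I : Type) (r : seq I) (P : pred I) (F : I -> V) :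
  (forall i, P i -> deg_ge k (F i)) -> deg_ge k (\sum_(i <- r | P i) F i).
Proof. by move=> kF; elim/big_ind: _ => //; [apply: deg_ge0 | apply: deg_geD]. Qed.

Lemma deg_ge_evec k : deg_ge k (ev k).
Proof. by move=> l lk; apply: evec_degree; rewrite neq_ltn lk. Qed.

Lemma deg_ge_fvec k : deg_ge k (fv k).
Proof. by move=> l lk; apply: fvec_degree; rewrite neq_ltn lk. Qed.

Lemma lead_deg_ge k v a c : lead k v a c -> deg_ge k v.
Proof.
move=> kv; rewrite -[v](subrK (a *: ev k + c *: fv k)).
apply: deg_geD; first exact: deg_ge_le kv.
by apply: deg_geD; apply: deg_geZ; [apply: deg_ge_evec | apply: deg_ge_fvec].
Qed.

Hypothesis pm : (p <= m)%N.

Lemma lead_inj k v a c a' c' : (0 < k <= p)%N ->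
  lead k v a c -> lead k v a' c' -> a = a' /\ c = c'.
Proof.
case: k => // k /= kp.
have coord v0 a0 c0 : lead k.+1 v0 a0 c0 ->
    a0 = v0 0 (lshift p (Ordinal (leq_trans kp pm)))
 /\ c0 = v0 0 (rshift m (Ordinal kp)).
  move=> H; split.
    have := H (lshift p (Ordinal (leq_trans kp pm))).
    rewrite /degree (unsplitK (inl _)) => /(_ (leqnn _)).
    rewrite (evecE _ _ (Ordinal (leq_trans kp pm))) (fvecE _ _ (Ordinal kp)).
    rewrite !mxE !eqxx eq_lrshift mulr1 mulr0 addr0 => /eqP.
    by rewrite subr_eq0 => /eqP.
  have := H (rshift m (Ordinal kp)).
  rewrite /degree (unsplitK (inr _)) => /(_ (leqnn _)).
  rewrite (evecE _ _ (Ordinal (leq_trans kp pm))) (fvecE _ _ (Ordinal kp)).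
  rewrite !mxE !eqxx eq_rlshift mulr1 mulr0 add0r => /eqP.
  by rewrite subr_eq0 => /eqP.
by move=> /coord[-> ->] /coord[-> ->].
Qed.

Lemma lead1_exists v : (0 < p)%N -> exists a c, lead 1 v a c.
Proof.
move=> p0; have m0 := leq_trans p0 pm.
exists (v 0 (lshift p (Ordinal m0))), (v 0 (rshift m (Ordinal p0))) => l.
rewrite (evecE _ _ (Ordinal m0)) (fvecE _ _ (Ordinal p0)) /degree.
rewrite -{2}(splitK l); case: (split l) => i; rewrite !ltnS leqn0 => /eqP i0.
  have -> : i = Ordinal m0 by apply: val_inj.
  by rewrite !mxE !eqxx /= eq_lrshift mulr1 mulr0 addr0 subrr.
have -> : i = Ordinal p0 by apply: val_inj.
by rewrite !mxE !eqxx /= eq_rlshift mulr1 mulr0 add0r subrr.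
Qed.

Lemma lead0 k : lead k 0 0 0.
Proof. by rewrite /lead !scale0r addr0 subr0; apply: deg_ge0. Qed.

Lemma lead_deg_gt k v : deg_ge k.+1 v -> lead k v 0 0.
Proof. by rewrite /lead !scale0r addr0 subr0. Qed.

Lemma lead_evec k : lead k (ev k) 1 0.
Proof. by rewrite /lead scale1r scale0r addr0 subrr; apply: deg_ge0. Qed.

Lemma lead_fvec k : lead k (fv k) 0 1.
Proof. by rewrite /lead scale1r scale0r add0r subrr; apply: deg_ge0. Qed.

Lemma leadZ k v a c b : lead k v a c -> lead k (b *: v) (b * a) (b * c).
Proof.
by move=> /(deg_geZ b); rewrite scalerBr scalerDr !scalerA; apply.
Qed.

Lemma leadD k v w a c a' c' : lead k v a c -> lead k w a' c' ->
  lead k (v + w) (a + a') (c + c').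
Proof.
move=> kv /(deg_geD kv); rewrite /lead !scalerDl => H.
by rewrite [X in _ - X]addrACA opprD addrACA.
Qed.

(** The common shape of the three tables: they respect the grading
    $\deg e_i = \deg f_i = i$, and only $e_i \circ e_j$ has a component along
    an $e_k$. *)
Definition graded_table (ee ef fe ff : nat -> nat -> V)
    (A B C D : nat -> nat -> K) : Prop :=
  forall i j, [/\ ee i j = A i j *: ev (i + j), ef i j = B i j *: fv (i + j),
                  fe i j = C i j *: fv (i + j) & ff i j = D i j *: fv (i + j)].

Section GradedTable.
Variables (ee ef fe ff : nat -> nat -> V) (A B C D : nat -> nat -> K).
Hypothesis gr_tab : graded_table ee ef fe ff A B C D.
Local Notation mul := (table_mul ee ef fe ff).

Lemma table_degree k l i : degree i != (degree k + degree l)%N ->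
  table ee ef fe ff k l 0 i = 0.
Proof.
rewrite [degree k]/degree [degree l]/degree /table.
by case: (split k) (split l) => a [] b ine;
  have [Eee Eef Efe Eff] := gr_tab a.+1 b.+1;
  rewrite ?Eee ?Eef ?Efe ?Eff mxE ?evec_degree ?fvec_degree ?mulr0.
Qed.

Lemma deg_geM j k v w : deg_ge j v -> deg_ge k w -> deg_ge (j + k) (mul v w).
Proof.
move=> jv kw l ljk; rewrite /table_mul summxE big1 // => a _.
rewrite summxE big1 // => b _; rewrite mxE.
have [aj|ja] := ltnP (degree a) j; first by rewrite jv // !mul0r.
have [bk|kb] := ltnP (degree b) k; first by rewrite kw // mulr0 mul0r.
by rewrite table_degree ?mulr0 // neq_ltn (leq_trans ljk) // leq_add.
Qed.

Lemma leadM j k v w a c a' c' : (0 < j <= p)%N -> (0 < k <= p)%N ->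
  lead j v a c -> lead k w a' c' ->
  lead (j + k) (mul v w) (a * a' * A j k)
    (a * c' * B j k + c * a' * C j k + c * c' * D j k).
Proof.
move=> jp kp jv kw.
have jm : (1 <= j <= m)%N by case/andP: jp => -> /leq_trans->.
have km : (1 <= k <= m)%N by case/andP: kp => -> /leq_trans->.
set v0 := a *: ev j + c *: fv j; set w0 := a' *: ev k + c' *: fv k.
have -> : mul v w = mul (v - v0) w + mul v0 (w - w0) + mul v0 w0.
  by rewrite -addrA -linearDr subrK -linearDl subrK.
have dv0 : deg_ge j v0.
  by apply: deg_geD; apply: deg_geZ; [apply: deg_ge_evec | apply: deg_ge_fvec].
have [Eee Eef Efe Eff] := gr_tab j k.
have -> : mul v0 w0 = (a * a' * A j k) *: ev (j + k)
    + (a * c' * B j k + c * a' * C j k + c * c' * D j k) *: fv (j + k).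
  rewrite linearDl !linearDr !linearZl_LR !linearZr_LR /=.
  rewrite table_mul_ee // table_mul_ef // table_mul_fe // table_mul_ff //.
  by rewrite Eee Eef Efe Eff !scalerA !scalerDl -!addrA.
rewrite /lead addrK; apply: deg_geD; last by rewrite -addnS; apply: deg_geM.
by rewrite -addSn; apply: deg_geM => //; apply: lead_deg_ge kw.
Qed.

End GradedTable.

(** ** Isomorphisms between graded tables *)

Section Isomorphism.
Variables (ee ef fe ff ee' ef' fe' ff' : nat -> nat -> V).
Variables (A B C D A' B' C' D' : nat -> nat -> K).
Hypotheses (gr_tab : graded_table ee ef fe ff A B C D)
           (gr_tab' : graded_table ee' ef' fe' ff' A' B' C' D').
Hypotheses (A1 : forall j, A 1%N j.+1 = 1) (B1 : forall j, B 1%N j.+1 = 1)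
           (A1' : forall j, A' 1%N j.+1 = 1) (B1' : forall j, B' 1%N j.+1 = 1).
Local Notation mul := (table_mul ee ef fe ff).
Local Notation mul' := (table_mul ee' ef' fe' ff').
Variable phi : {linear V -> V}.
Hypotheses (phi_bij : bijective phi)
           (phiM : forall v w, phi (mul v w) = mul' (phi v) (phi w)).
Hypothesis p3 : (3 <= p)%N.

Let p0 : (0 < p)%N. Proof. exact: leq_trans p3. Qed.
Let m0 : (0 < m)%N. Proof. exact: leq_trans pm. Qed.

Lemma deg_ge1 v : deg_ge 1 v.
Proof. by move=> l; rewrite ltnS leqn0 => /eqP; have := degree_gt0 l; lia. Qed.

Lemma iso_deg2 v : deg_ge 2 v -> deg_ge 2 (phi v).
Proof.
have phi_mul u w : deg_ge 2 (phi (mul u w)).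
  by rewrite phiM -[2%N]/(1 + 1)%N; apply: (deg_geM gr_tab'); apply: deg_ge1.
move=> v2; rewrite (matrix_sum_delta v) big_ord1 linear_sum; apply: deg_ge_sum => l _.
rewrite linearZ /=; have [l2|] := ltnP (degree l) 2.
  by rewrite v2 // scale0r; apply: deg_ge0.
rewrite /degree -{3}(splitK l); case: (split l) => -[[|i] ip] //= _; apply: deg_geZ.
  rewrite -(evecE _ _ (Ordinal ip)) /=.
  suff -> : ev i.+2 = mul (ev 1) (ev i.+1) by apply: phi_mul.
  rewrite table_mul_ee ?m0 ?(ltnW ip) //.
  by have [-> _ _ _] := gr_tab 1 i.+1; rewrite A1 scale1r.
rewrite -(fvecE _ _ (Ordinal ip)) /=.
suff -> : fv i.+2 = mul (ev 1) (fv i.+1) by apply: phi_mul.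
rewrite table_mul_ef ?m0 ?(ltnW ip) //.
by have [_ -> _ _] := gr_tab 1 i.+1; rewrite B1 scale1r.
Qed.

(** Since the isomorphism preserves the part of degree at least $2$, it
    induces a surjective $2 \times 2$ matrix on the leading terms of
    degree $1$. *)
Lemma iso_lead_onto a c a' c' x y :
  lead 1 (phi (ev 1)) a c -> lead 1 (phi (fv 1)) a' c' ->
  exists s t, s * a + t * a' = x /\ s * c + t * c' = y.
Proof.
move=> phi_e phi_f; have [psi _ psiK] := phi_bij.
pose w := x *: ev 1 + y *: fv 1.
have [s [t st]] := lead1_exists (psi w) p0; exists s, t.
have : lead 1 w x y.
  have := leadD (leadZ x (@lead_evec 1)) (leadZ y (@lead_fvec 1)).
  by rewrite !mulr1 !mulr0 addr0 add0r.
rewrite -[w in lead _ w]psiK; set u := psi w in st *.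
have -> : phi u = phi (u - (s *: ev 1 + t *: fv 1)) + (s *: phi (ev 1) + t *: phi (fv 1)).
  by rewrite -!linearZ -!linearD subrK.
have := leadD (lead_deg_gt (iso_deg2 st)) (leadD (leadZ s phi_e) (leadZ t phi_f)).
by rewrite !add0r => H1 /(lead_inj _ H1) [].
Qed.

Hypothesis D11 : D 1%N 1%N = 0.

(** The square-zero element $f_1$ has to go to a multiple of $f_1$ modulo
    $A^2$, and then the relation $f_1 \circ e_1 = \beta_1 e_1 \circ f_1$ is
    carried over. *)
Lemma iso_lead : exists a c d,
  [/\ lead 1 (phi (ev 1)) a c, lead 1 (phi (fv 1)) 0 d, a != 0 & d != 0]
  /\ D' 1%N 1%N = 0 /\ C 1%N 1%N = C' 1%N 1%N.
Proof.
have [a [c phi_e]] := lead1_exists (phi (ev 1)) p0.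
have [a' [d phi_f]] := lead1_exists (phi (fv 1)) p0.
have p01 : (0 < 1 <= p)%N by rewrite p0.
have p02 : (0 < 2 <= p)%N by rewrite (ltnW p3).
have ff0 : mul (fv 1) (fv 1) = 0.
  rewrite table_mul_ff ?p0 //.
  by have [_ _ _ ->] := gr_tab 1 1; rewrite D11 scale0r.
have := leadM gr_tab' p01 p01 phi_f phi_f.
rewrite -phiM ff0 linear0 => /(lead_inj p02 (@lead0 2)) [].
rewrite A1' mulr1 => /esym/eqP; rewrite mulf_eq0 orbb => /eqP a'0.
rewrite {}a'0 in phi_f *; rewrite !mul0r mulr0 mul0r !add0r => ddD.
have onto x y := iso_lead_onto x y phi_e phi_f.
have a0 : a != 0.
  have [s [t [+ _]]] := onto 1 0; rewrite mulr0 addr0 => sa.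
  by apply: contra_eq_neq sa => ->; rewrite mulr0 eq_sym oner_eq0.
have d0 : d != 0.
  have [s [t [/eqP + td]]] := onto 0 1.
  rewrite mulr0 addr0 mulf_eq0 (negPf a0) orbF => /eqP s0.
  apply: contra_eq_neq td => ->; rewrite s0 mul0r mulr0 addr0.
  by rewrite eq_sym oner_eq0.
have D'0 : D' 1%N 1%N = 0.
  by apply/eqP; move/esym/eqP: ddD; rewrite !mulf_eq0 (negPf d0).
exists a, c, d; split=> //; split=> //.
have fe_ef : mul (fv 1) (ev 1) = C 1%N 1%N *: mul (ev 1) (fv 1).
  rewrite table_mul_fe ?p0 ?m0 // table_mul_ef ?p0 ?m0 //.
  by have [_ -> -> _] := gr_tab 1 1; rewrite B1 scale1r.
have := leadM gr_tab' p01 p01 phi_f phi_e.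
rewrite -phiM fe_ef linearZ /= phiM.
have := leadZ (C 1%N 1%N) (leadM gr_tab' p01 p01 phi_e phi_f).
move=> /lead_inj H /H [] // _.
rewrite B1' D'0 !mulr0 !mul0r !addr0 mulr1 add0r [d * a]mulrC [RHS]mulrC.
by move/(mulIf (mulf_neq0 a0 d0)).
Qed.

(** The images of $e_1$ and $f_1$ have leading terms $a e_1 + c f_1$ and
    $d f_1$.  As long as $f_1 \circ f_j = 0$ in the target, the image of $f_j$
    has leading term $a^{j-1} d f_j$, so that $f_1 \circ f_{p-1} = 0$ in the
    source forces the same in the target. *)
Lemma iso_last : (forall j, (0 < j < p.-1)%N -> D' 1%N j = 0) ->
  (forall j, (0 < j <= p)%N -> D 1%N j = 0) -> D' 1%N p.-1 = 0.
Proof.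
move=> D'0 D0; have [a [c [d [[phi_e phi_f a0 d0] _]]]] := iso_lead.
have p01 : (0 < 1 <= p)%N by rewrite p0.
have phi_lead k : (k < p.-1)%N -> lead k.+1 (phi (fv k.+1)) 0 (a ^+ k * d).
  elim: k => [|k IHk] kp; first by rewrite mul1r.
  have -> : fv k.+2 = mul (ev 1) (fv k.+1).
    rewrite table_mul_ef ?m0 //; last by lia.
    by have [_ -> _ _] := gr_tab 1 k.+1; rewrite B1 scale1r.
  rewrite phiM.
  have := leadM gr_tab' p01 (_ : 0 < k.+1 <= p)%N phi_e (IHk (ltnW kp)).
  move=> /(_ ltac:(lia)); rewrite B1' D'0; last by lia.
  by rewrite !mulr0 !mul0r !addr0 mulr1 exprS mulrA add1n.
have p21 : (p.-2 < p.-1)%N by lia.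
have p1p : (0 < p.-1 <= p)%N by lia.
have := phi_lead _ p21; rewrite (_ : p.-2.+1 = p.-1); last by lia.
move=> /(leadM gr_tab' p01 p1p phi_f).
rewrite -phiM table_mul_ff; [|by lia..].
have [_ _ _ ->] := gr_tab 1 p.-1; rewrite D0; last by lia.
rewrite scale0r linear0 !mul0r mulr0 mul0r !add0r (_ : 1 + p.-1 = p)%N; last by lia.
move=> /(lead_inj _ (@lead0 p)) [|_ /esym/eqP]; first by lia.
by rewrite !mulf_eq0 (negPf d0) expf_eq0 (negPf a0) andbF => /eqP.
Qed.

End Isomorphism.

End Degrees.

Section NonIsomorphism.
Variables (K : numFieldType) (m p : nat).
Hypotheses (p3 : (3 <= p)%N) (pm : (p <= m)%N).
Implicit Types (b : K).

Let cbin (i j : nat) : K := 'C(i + j - 1, j)%:R.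
Let last_ff (i j : nat) : K := ((i == 1)%N && (j == p - 1)%N)%:R.

Fact scale_evec_if k (c : K) :
  (if (k <= m)%N then c *: evec K m p k else 0) = c *: evec K m p k.
Proof.
case: leqP => // mk; rewrite (_ : evec K m p k = 0) ?scaler0 //.
by apply/rowP=> l; rewrite !mxE [(k <= m)%N]leqNgt mk andbF.
Qed.

Fact scale_fvec_if k (c : K) :
  (if (k <= p)%N then c *: fvec K m p k else 0) = c *: fvec K m p k.
Proof.
case: leqP => // pk; rewrite (_ : fvec K m p k = 0) ?scaler0 //.
by apply/rowP=> l; rewrite !mxE [(k <= p)%N]leqNgt pk andbF.
Qed.

Fact graded_A1 b :
  graded_table (tab_ee K m p) (tab_ef m p (beta1 b)) (tab_fe m p (beta1 b))
    (fun _ _ => 0) cbin (coef_ef (beta1 b)) (coef_fe (beta1 b)) (fun _ _ => 0).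
Proof.
by move=> i j; split; [exact: scale_evec_if | exact: scale_fvec_if
  | exact: scale_fvec_if | rewrite scale0r].
Qed.

Fact graded_A2 :
  graded_table (tab_ee K m p) (tab_ef m p (beta2 K p)) (tab_fe m p (beta2 K p))
    (fun i j => if (i == 1)%N && (j == p - 1)%N then fvec K m p p else 0)
    cbin (coef_ef (beta2 K p)) (coef_fe (beta2 K p)) last_ff.
Proof.
move=> i j; split; [exact: scale_evec_if | exact: scale_fvec_if
  | exact: scale_fvec_if | rewrite /last_ff].
case: andP => [[/eqP-> /eqP->]|_]; last by rewrite scale0r.
by rewrite scale1r; congr fvec; lia.
Qed.

Fact graded_A3 :
  graded_table (tab_ee K m p) (tab_f K m p) (tab_f K m p) (tab_f K m p)
    cbin cbin cbin cbin.
Proof.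
by move=> i j; split; [exact: scale_evec_if | exact: scale_fvec_if
  | exact: scale_fvec_if | exact: scale_fvec_if].
Qed.

Fact cbin1 j : cbin 1 j.+1 = 1.
Proof. by rewrite /cbin addKn binn. Qed.

Fact last_ff11 : last_ff 1 1 = 0.
Proof. by rewrite /last_ff (_ : (1 == p - 1)%N = false) //; apply/eqP; lia. Qed.

Fact beta1_0 b : beta1 b 0 = 1.
Proof. by rewrite /beta1 big_nil. Qed.

Fact beta2_0 : beta2 K p 0 = 1.
Proof. by rewrite /beta2 bin0 mulr1. Qed.

Lemma A1_inj b b' : alg_iso (algA1 m p b) (algA1 m p b') -> b = b'.
Proof.
move=> [phi [phi_bij phiM]].
have [_ [_ [_ [_ [_]]]]] := iso_lead pm (graded_A1 b) (graded_A1 b')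
  cbin1 (fun j => coef_ef1 j (beta1_0 b)) cbin1 (fun j => coef_ef1 j (beta1_0 b'))
  phi_bij phiM p3 (erefl 0).
by rewrite !coef_fe1 !beta1_1.
Qed.

Lemma A1_not_A2 b : ~ alg_iso (algA1 m p b) (algA2 K m p).
Proof.
move=> [phi [phi_bij phiM]].
have := iso_last pm (graded_A1 b) graded_A2
  cbin1 (fun j => coef_ef1 j (beta1_0 b)) cbin1 (fun j => coef_ef1 j beta2_0)
  phi_bij phiM p3 (erefl 0).
move=> /(_ _ (fun _ _ => erefl 0)) => last0.
suff : last_ff 1 p.-1 = 0 by rewrite /last_ff subn1 !eqxx => /eqP; rewrite oner_eq0.
apply: last0 => j jp.
by rewrite /last_ff (_ : (j == p - 1)%N = false) //; apply/eqP; lia.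
Qed.

Lemma A1_not_A3 b : ~ alg_iso (algA1 m p b) (algA3 K m p).
Proof.
move=> [phi [phi_bij phiM]].
have [_ [_ [_ [_ [+ _]]]]] := iso_lead pm (graded_A1 b) graded_A3
  cbin1 (fun j => coef_ef1 j (beta1_0 b)) cbin1 cbin1 phi_bij phiM p3 (erefl 0).
by rewrite cbin1 => /eqP; rewrite oner_eq0.
Qed.

Lemma A2_not_A3 : ~ alg_iso (algA2 K m p) (algA3 K m p).
Proof.
move=> [phi [phi_bij phiM]].
have [_ [_ [_ [_ [+ _]]]]] := iso_lead pm graded_A2 graded_A3
  cbin1 (fun j => coef_ef1 j beta2_0) cbin1 cbin1 phi_bij phiM p3 last_ff11.
by rewrite cbin1 => /eqP; rewrite oner_eq0.
Qed.

End NonIsomorphism.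

(** * Homogeneous generators *)

Section Grading.
Variables (K : numFieldType) (V : vectType K) (mul : {bilinear V -> V -> V}).
Local Notation "x ** y" := (mul x y) (at level 40, left associativity).

(** A positive grading of the algebra, given by its projections; the last
    clause says that the component of degree $1$ is a complement of $A^2$. *)
Definition grading (N : nat) (pi : nat -> 'End(V)) : Prop :=
  [/\ forall v, v = \sum_(k < N) pi k v,
      forall v, pi 0%N v = 0,
      forall k l v, pi k (pi l v) = if k == l then pi l v else 0,
      forall k u v, pi k (u ** v) = \sum_(i < k.+1) pi i u ** pi (k - i)%N v
    & forall v, pi 1%N v = 0 -> v \in mulv mul fullv fullv].

Section NaturalGrading.
Variables (s : nat) (phi : {linear V -> gr mul s}) (psi : gr mul s -> V).
Hypotheses (phiK : cancel phi psi) (psiK : cancel psi phi).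
Hypothesis phiM : forall u v, phi (u ** v) = gr_mul (phi u) (phi v).
Hypothesis As0 : alg_pow mul s = 0%VS.
Hypothesis s0 : (0 < s)%N.

Let dsum_funD (x y : gr mul s) i : dsum_fun (x + y) i = dsum_fun x i + dsum_fun y i.
Proof. exact: dsum_ofE. Qed.

Let dsum_funZ a (x : gr mul s) i : dsum_fun (a *: x) i = a *: dsum_fun x i.
Proof. exact: dsum_ofE. Qed.

Let dsum_fun0 i : dsum_fun (0 : gr mul s) i = 0.
Proof. exact: dsum_ofE. Qed.

Let dsum_fun_sum (I : finType) (F : I -> gr mul s) i :
  dsum_fun (\sum_j F j) i = \sum_j dsum_fun (F j) i.
Proof.
exact: (big_morph (fun x : gr mul s => dsum_fun x i)
          (fun x y => dsum_funD x y i) (dsum_fun0 i)).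
Qed.

Definition homog_part (k : nat) (x : gr mul s) : gr mul s :=
  dsum_of (fun i : 'I_s.-1 => if k == i.+1 then dsum_fun x i else 0).

Definition gr_proj k (v : V) : V := psi (homog_part k (phi v)).

Fact gr_proj_linear k : linear (gr_proj k).
Proof.
move=> a u v; apply: (can_inj phiK); rewrite /gr_proj [RHS]linearP /= !psiK.
apply: dsumP => i; rewrite dsum_funD dsum_funZ !dsum_ofE linearP /=.
by rewrite dsum_funD dsum_funZ; case: ifP => // _; rewrite scaler0 addr0.
Qed.
HB.instance Definition _ k :=
  GRing.isLinear.Build K V V _ (gr_proj k) (gr_proj_linear k).

Lemma gr_projE k v i :
  dsum_fun (phi (gr_proj k v)) i = if k == i.+1 then dsum_fun (phi v) i else 0.
Proof. by rewrite psiK dsum_ofE. Qed.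

Lemma gr_inj u v :
  (forall i, dsum_fun (phi u) i = dsum_fun (phi v) i) -> u = v.
Proof. by move=> uv; apply: (can_inj phiK); apply: dsumP. Qed.

Lemma gr_mulE u v k : dsum_fun (phi (u ** v)) k =
  \sum_(i < s.-1) \sum_(j < s.-1 | (i.+1 + j.+1 == k.+1)%N)
      gr_pi mul k (quot_repr (dsum_fun (phi u) i) ** quot_repr (dsum_fun (phi v) j)).
Proof. by rewrite phiM /gr_mul dsum_ofE. Qed.

Lemma gr_proj_mul k u v :
  gr_proj k (u ** v) = \sum_(i < k.+1) gr_proj i u ** gr_proj (k - i)%N v.
Proof.
have repr0 U W : quot_repr (0 : quotv U W) = 0 by rewrite /quot_repr linear0.
have pi0 l : gr_pi mul l 0 = 0 by rewrite /gr_pi /quot_pi !linear0.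
apply: gr_inj => j; rewrite gr_projE linear_sum dsum_fun_sum.
under eq_bigr => i _ do rewrite gr_mulE.
rewrite exchange_big /=; case: eqP => [kj|kj]; last first.
  rewrite big1 // => a _; rewrite big1 // => i _; rewrite big1 // => b /eqP ab.
  rewrite !gr_projE; case: eqP => [ia|_]; last by rewrite repr0 linear0l pi0.
  case: eqP => [ib|_]; last by rewrite repr0 linear0r pi0.
  by case: kj; have := ltn_ord i; lia.
rewrite gr_mulE; apply: eq_bigr => a _; rewrite exchange_big /=.
apply: eq_bigr => b /eqP ab.
have ak : (a.+1 < k.+1)%N by lia.
rewrite (bigD1 (Ordinal ak)) //= !gr_projE eqxx (_ : _ == b.+1); last by apply/eqP; lia.
rewrite [X in _ + X]big1 ?addr0 // => i ia; rewrite !gr_projE.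
by rewrite (_ : (i == a.+1 :> nat) = false) ?repr0 ?linear0l ?pi0 //; apply/negbTE.
Qed.

(** The projection to the component of degree $1$ kills $A^2$, and its rank is
    the dimension of $A / A^2$; so its kernel cannot be larger. *)
Lemma gr_proj1_ker v : gr_proj 1 v = 0 -> v \in alg_pow mul 2.
Proof.
have [s1|s1] := posnP s.-1.
  have {}s1 : s = 1%N by lia.
  have : v \in alg_pow mul s by rewrite s1 memvf.
  by rewrite As0 memv0 => /eqP-> _; rewrite mem0v.
pose o := Ordinal s1; pose h (w : V) : gr_comp mul o := dsum_fun (phi w) o.
have h_lin : linear h by move=> a u w; rewrite /h linearP dsum_funD dsum_funZ.
pose hL : {linear V -> gr_comp mul o} := HB.pack h (GRing.isLinear.Build K V _ _ h h_lin).
pose H := linfun hL.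
have HE w : H w = dsum_fun (phi w) o by rewrite lfunE.
move=> v1; have Hv : v \in lker H.
  rewrite memv_ker HE; apply/eqP; have := gr_projE 1 v o.
  by rewrite v1 linear0 dsum_fun0 => /esym.
suff -> : alg_pow mul 2 = lker H by [].
have sub : (alg_pow mul 2 <= lker H)%VS.
  apply/mulvP => u w _ _; rewrite memv_ker HE gr_mulE big1 // => i _.
  by rewrite big1 // => j /eqP /=; lia.
apply/eqP; rewrite eqEdim sub /=.
have imH : limg H = fullv.
  apply/eqP; rewrite eqEsubv subvf; apply/subvP => q _; apply/memv_imgP.
  pose x : gr mul s := dsum_of (fun i : 'I_s.-1 =>
    if i =P o is ReflectT io then ecast j (gr_comp mul j) (esym io) q else 0).
  exists (psi x); first exact: memvf.
  rewrite HE psiK dsum_ofE; case: eqP => // oo.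
  by rewrite (eq_irrelevance oo (erefl o)).
have := limg_ker_dim H fullv; rewrite capfv imH dimvf.
have := dimv_cap_compl (alg_pow mul 1) (alg_pow mul 2).
rewrite capfv [in RHS]/= => dimA dimH.
by rewrite -(leq_add2r (dim (gr_comp mul o))) dimH -dimA.
Qed.

Lemma gr_grading : grading s (fun k => linfun (gr_proj k)).
Proof.
split=> [v|v|k l v|k u v|v]; rewrite ?lfunE /=.
- apply: gr_inj => i; rewrite linear_sum dsum_fun_sum.
  have i_s : (i.+1 < s)%N by have := ltn_ord i; lia.
  rewrite (bigD1 (Ordinal i_s)) //= lfunE /= gr_projE eqxx big1 ?addr0 // => k ki.
  by rewrite lfunE /= gr_projE (_ : (k == i.+1 :> nat) = false) //; apply/negbTE.
- by apply: gr_inj => i; rewrite gr_projE linear0 dsum_fun0.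
- apply: gr_inj => i; rewrite gr_projE; case: (eqVneq k l) => [->|kl].
    by rewrite !gr_projE; case: eqP.
  rewrite gr_projE linear0 dsum_fun0; case: eqP => // ki; case: eqP => // li.
  by rewrite ki li eqxx in kl.
- by rewrite gr_proj_mul; apply: eq_bigr => i _; rewrite !lfunE.
- exact: gr_proj1_ker.
Qed.

End NaturalGrading.

Lemma naturally_graded_grading : naturally_graded mul ->
  exists N pi, grading N pi.
Proof.
move=> [s [s0 As0 _] [phi [[psi phiK psiK] phiM]]].
by exists s; eexists; apply: (gr_grading phiK psiK phiM As0 s0).
Qed.
End Grading.

Section HomogeneousGenerators.
Variables (K : numFieldType) (V : vectType K) (mul : {bilinear V -> V -> V}).
Hypothesis zin : zinbiel mul.
Local Notation "x ** y" := (mul x y) (at level 40, left associativity).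
Variables (N : nat) (pi : nat -> 'End(V)).
Hypothesis pi_grading : grading mul N pi.

Lemma pi_sum v : v = \sum_(k < N) pi k v.
Proof. by case: pi_grading. Qed.

Lemma pi0 v : pi 0 v = 0.
Proof. by case: pi_grading. Qed.

Lemma pi_pi k l v : pi k (pi l v) = if k == l then pi l v else 0.
Proof. by case: pi_grading. Qed.

Lemma pi_mul k u v : pi k (u ** v) = \sum_(i < k.+1) pi i u ** pi (k - i)%N v.
Proof. by case: pi_grading. Qed.

Lemma pi1_mul u v : pi 1 (u ** v) = 0.
Proof.
by rewrite pi_mul !big_ord_recl big_ord0 /= !pi0 linear0l linear0r !addr0.
Qed.

Lemma pi_pi_mul i j u v : pi (i + j) (pi i u ** pi j v) = pi i u ** pi j v.
Proof.
have ij : (i < (i + j).+1)%N by lia.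
rewrite pi_mul (bigD1 (Ordinal ij)) //= addKn !pi_pi !eqxx big1 ?addr0 // => k ki.
by rewrite pi_pi (_ : (k == i :> nat) = false) ?linear0l //; apply/negbTE.
Qed.

Definition from_deg k v := forall i, (i < k)%N -> pi i v = 0.

Lemma from_deg1 v : from_deg 1 v.
Proof. by move=> [|i] // _; apply: pi0. Qed.

Lemma from_degM j k u v : from_deg j u -> from_deg k v -> from_deg (j + k) (u ** v).
Proof.
move=> ju kv i ijk; rewrite pi_mul big1 // => l _.
have [lj|jl] := ltnP l j; first by rewrite ju // linear0l.
by rewrite [pi (i - l)%N v]kv ?linear0r //; have := ltn_ord l; lia.
Qed.

Lemma pi_mul_lead k u v : from_deg k v ->
  pi k.+1 (u ** v) = pi 1 u ** pi k v.
Proof.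
move=> kv; have k1 : (1 < k.+2)%N by [].
rewrite pi_mul (bigD1 (Ordinal k1)) //= subn1 big1 ?addr0 // => i.
rewrite -val_eqE /= => i1; have [->|i0] := posnP i; first by rewrite pi0 linear0l.
by rewrite [pi (_ - _)%N v]kv ?linear0r //; have := ltn_ord i; lia.
Qed.

(** Chains that start at inhomogeneous elements have homogeneous chains as
    their parts of lowest degree; this is how the vanishing of a chain is
    inherited by the parts of degree $1$ of its generators. *)
Lemma chain_lead u v i :
  from_deg i.+1 (chain mul u v i)
  /\ pi i.+1 (chain mul u v i) = chain mul (pi 1 u) (pi 1 v) i.
Proof.
elim: i => [|i [IHd IHl]]; first by split=> //; apply: from_deg1.
rewrite !chainS; split.
  by rewrite -[i.+2]add1n; apply: from_degM => //; apply: from_deg1.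
by rewrite pi_mul_lead // IHl.
Qed.

Lemma pi_chain u v i :
  pi i.+1 (chain mul (pi 1 u) (pi 1 v) i) = chain mul (pi 1 u) (pi 1 v) i.
Proof. by rewrite -(chain_lead u v i).2 pi_pi eqxx. Qed.

(** An algebra whose component of degree $1$ is a line is a quotient of the
    free Zinbiel algebra on one generator. *)
Lemma one_generator u : (forall v, exists c, pi 1 v = c *: pi 1 u) ->
  forall j v, exists c, pi j.+1 v = c *: chain mul (pi 1 u) (pi 1 u) j.
Proof.
set x := pi 1 u => gen j; have [n] := ubnP j; elim: n j => // n IHn [|j] jn v //.
have : pi j.+2 v \in mulv mul fullv fullv.
  by case: pi_grading => _ _ _ _; apply; rewrite pi_pi.
suff: (mulv mul fullv fullv <= pi j.+2 @^-1: <[chain mul x x j.+1]>)%VS.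
  move=> /subvP sub /sub; rewrite -memv_preim pi_pi eqxx => /vlineP[c vE].
  by exists c.
apply/mulvP => a b _ _; rewrite -memv_preim pi_mul memv_suml // => -[[|i] ij] _ /=.
  by rewrite pi0 linear0l mem0v.
have [->|ji] := eqVneq i j.+1; first by rewrite subnn pi0 linear0r mem0v.
have [c ->] := IHn i ltac:(lia) a.
rewrite (_ : j.+2 - i.+1 = (j - i).+1)%N; last by lia.
have [d ->] := IHn (j - i)%N ltac:(lia) b.
rewrite linearZl_LR linearZr_LR /= !memvZ // mul_chain_self //.
by rewrite subnKC ?memvZ ?memv_line //; lia.
Qed.

Variables (m p : nat) (g h : V).
Hypotheses (p0 : (0 < p)%N) (pm : (p < m)%N).
Hypotheses (gh_basis : basis_of fullv ([seq chain mul g g i | i <- iota 0 m]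
                                       ++ [seq chain mul g h i | i <- iota 0 p]))
           (g_last : chain mul g g m = 0) (h_last : chain mul g h p = 0).

Local Notation x := (pi 1 g).
Local Notation y := (pi 1 h).
Local Notation X := (chain mul x x).
Local Notation Y := (chain mul x y).

Lemma dim_gh : \dim {:V} = (m + p)%N.
Proof.
rewrite -(span_basis gh_basis) (eqP (basis_free gh_basis)).
by rewrite size_cat !size_map !size_iota.
Qed.

Lemma gh_decomp v : exists a b w, v = a *: g + b *: h + g ** w.
Proof.
have : v \in (<[g]> + <[h]> + limg (linfun (mul g)))%VS.
  apply: (subvP _ _ (memvf v)).
  move: gh_basis; rewrite basisEdim => /andP[/subv_trans-> //].
  have gL w : g ** w \in limg (linfun (mul g)).
    by apply/memv_imgP; exists w; [apply: memvf | rewrite lfunE].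
  apply/span_subvP => w; rewrite mem_cat => /orP[] /mapP[[|i] _ ->].
  - by rewrite -addvA (subvP (addvSl _ _)) ?memv_line.
  - by rewrite (subvP (addvSr _ _)) // chainS gL.
  - by rewrite (subvP (addvSl _ _)) // (subvP (addvSr _ _)) ?memv_line.
  - by rewrite (subvP (addvSr _ _)) // chainS gL.
move=> /memv_addP[_ /memv_addP[_ /vlineP[a ->] [_ /vlineP[b ->] ->]]].
move=> [_ /memv_imgP[w _ ->] ->].
by exists a, b, w; rewrite lfunE.
Qed.

Lemma pi1_gh v : exists a b, pi 1 v = a *: x + b *: y.
Proof.
have [a [b [w ->]]] := gh_decomp v; exists a, b.
by rewrite !linearD !linearZ /= pi1_mul addr0.
Qed.

Lemma X_last : X m = 0.
Proof. by rewrite -(chain_lead g g m).2 g_last linear0. Qed.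

Lemma Y_last : Y p = 0.
Proof. by rewrite -(chain_lead g h p).2 h_last linear0. Qed.

(** The members of a chain with homogeneous generators have different degrees,
    hence are independent as long as they do not vanish. *)
Lemma chain_dim k u : chain mul (pi 1 u) (pi 1 u) k != 0 -> (k.+1 <= \dim {:V})%N.
Proof.
set z := pi 1 u => zk.
pose t := [tuple chain mul z z i | i < k.+1].
rewrite -[k.+1](size_tuple t) (_ : size t = \dim <<t>>) ?dimvS ?subvf //.
apply/esym/eqP/freeP => a sum0 i.
have := congr1 (pi i.+1) sum0; rewrite linear0 linear_sum (bigD1 i) //=.
rewrite linearZ /= (nth_map i) ?size_enum_ord // nth_ord_enum pi_chain.
rewrite big1 ?addr0 => [/eqP|j ji]; last first.
  rewrite linearZ /= (nth_map i) ?size_enum_ord // nth_ord_enum.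
  rewrite -pi_chain pi_pi eqSS (_ : (i == j :> nat) = false) ?scaler0 //.
  by apply/negbTE; rewrite eq_sym.
rewrite scaler_eq0 => /orP[/eqP //|/eqP zi]; case/eqP: zk.
by apply: chain_eq0 zi; rewrite -ltnS.
Qed.

Lemma span_homogeneous (W : {vspace V}) :
  (forall k v, pi k v \in W) -> (fullv <= W)%VS.
Proof.
by move=> piW; apply/subvP => v _; rewrite [v]pi_sum memv_suml.
Qed.

(** If $e_1$ generates modulo $A^2$, the dimension is at most $m$. *)
Lemma x_not_generator : ~ forall v, exists c, pi 1 v = c *: x.
Proof.
move=> gen; pose W := <<[seq X i | i <- iota 0 m]>>%VS.
suff: (\dim {:V} <= m)%N by rewrite dim_gh; lia.
rewrite (leq_trans (dimvS (_ : fullv <= W)%VS)) //; last first.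
  by rewrite (leq_trans (dim_span _)) // size_map size_iota.
apply: span_homogeneous => -[|k] v; first by rewrite pi0 mem0v.
have [c ->] := one_generator gen k v.
have [km|mk] := ltnP k m; last by rewrite (chain_eq0 mk X_last) scaler0 mem0v.
by rewrite memvZ // memv_span // map_f // mem_iota.
Qed.

(** If $e_1 \in A^2$, then $e_m$ has degree at least $2m$ in an algebra
    generated by $f_1$, whose dimension is then at least $2m$. *)
Lemma x_neq0 : x <> 0.
Proof.
move=> x0; have gen v : exists c, pi 1 v = c *: y.
  by have [a [c ->]] := pi1_gh v; exists c; rewrite x0 scaler0 add0r.
have g2 : from_deg 2 g by move=> [|[|i]] //; rewrite pi0.
have gi i : from_deg i.+1.*2 (chain mul g g i).
  elim: i => // i IHi; rewrite chainS doubleS -[_.+2]add2n.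
  exact: from_degM.
have gm : chain mul g g m.-1 != 0.
  rewrite (free_not0 (basis_free gh_basis)) // mem_cat map_f // mem_iota.
  by lia.
case/eqP: gm; rewrite [LHS]pi_sum big1 // => -[[|k] kN] _ /=; first exact: pi0.
have [km|mk] := ltnP k.+1 m.*2; first by apply: gi; lia.
have [c ->] := one_generator gen k (chain mul g g m.-1).
have [->|/chain_dim] := eqVneq (chain mul y y k) 0; first by rewrite scaler0.
by rewrite dim_gh => kn; exfalso; lia.
Qed.

(** Otherwise the algebra would be generated by one element. *)
Lemma xy_indep a b : a *: x + b *: y = 0 -> a = 0 /\ b = 0.
Proof.
move=> xy0; have x0 := x_neq0.
have [b0|b0] := eqVneq b 0.
  move/eqP: xy0; rewrite b0 scale0r addr0 scaler_eq0 => /orP[/eqP-> //|/eqP //].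
case: x_not_generator => v; have [s [t ->]] := pi1_gh v.
exists (s - t / b * a); rewrite scalerBl -scalerA.
rewrite (_ : a *: x = - (b *: y)); last by apply/eqP; rewrite -addr_eq0 xy0.
by rewrite scalerN opprK scalerA divfK.
Qed.

Lemma square_left_multiples v : pi 1 v = 0 -> exists w, v = g ** w.
Proof.
have [a [b [w ->]]] := gh_decomp v; rewrite !linearD !linearZ /= pi1_mul addr0.
by move=> /xy_indep[-> ->]; exists w; rewrite !scale0r !add0r.
Qed.

(** From $A^2 = e_1 \circ A$ to $A_{j+1} = x \circ A_j$, where $x$ is the part
    of degree $1$ of $e_1$: the other parts of $e_1$ lie, inductively, in
    $x \circ A$, and $(x \circ b) \circ c = x \circ (b \circ c + c \circ b)$. *)
Lemma pi_left_multiples j v : exists w, pi j.+2 v = x ** pi j.+1 w.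
Proof.
have [n] := ubnP j; elim: n j v => // n IHn j v jn.
pose S := limg (linfun (mul x) \o pi j.+1)%VF.
have inS w : x ** pi j.+1 w \in S.
  by apply/memv_imgP; exists w; [apply: memvf | rewrite comp_lfunE lfunE].
suff /memv_imgP[w _ ->] : pi j.+2 v \in S by exists w; rewrite comp_lfunE lfunE.
have [u uE] : exists u, pi j.+2 v = g ** u.
  by apply: square_left_multiples; rewrite pi_pi.
rewrite -[pi j.+2 v]/(if true then pi j.+2 v else 0) -(eqxx j.+2) -pi_pi uE.
rewrite pi_mul memv_suml // => -[[|[|i]] ij] _ /=.
- by rewrite pi0 linear0l mem0v.
- by rewrite subn1.
have [->|ij'] := eqVneq i j; first by rewrite subnn pi0 linear0r mem0v.
have [w ->] := IHn i g ltac:(lia).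
rewrite zin -linearDr (_ : j.+2 - i.+2 = j - i)%N //.
rewrite -[X in X + _]pi_pi_mul -[X in _ + X]pi_pi_mul.
rewrite (_ : i.+1 + (j - i) = j.+1)%N; last by lia.
rewrite (_ : j - i + i.+1 = j.+1)%N; last by lia.
by rewrite -[X in x ** X]linearD; apply: inS.
Qed.

Lemma pi_XY j v : exists a b, pi j.+1 v = a *: X j + b *: Y j.
Proof.
elim: j v => [|j IHj] v; first exact: pi1_gh.
have [w ->] := pi_left_multiples j v; have [a [b ->]] := IHj w.
by exists a, b; rewrite linearDr !linearZr_LR.
Qed.

(** The $m + p$ chain vectors form a basis because they span an algebra of
    dimension $m + p$. *)
Lemma homogeneous_adapted : adapted mul m p x y.
Proof.
split; rewrite ?X_last ?Y_last //; first last.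
- by move=> l; have := pi_XY l.+1 (y ** Y l); rewrite -[l.+2]add1n -pi_chain pi_pi_mul.
- by have := pi_XY 1 (y ** x); rewrite -[2%N]/(1 + 1)%N pi_pi_mul.
rewrite basisEdim size_cat !size_map !size_iota dim_gh leqnn andbT.
apply: span_homogeneous => -[|k] v; first by rewrite pi0 mem0v.
have [a [b ->]] := pi_XY k v; apply: memvD; apply: memvZ.
  have [km|mk] := ltnP k m; last by rewrite (chain_eq0 mk X_last) mem0v.
  by rewrite memv_span // mem_cat map_f // mem_iota.
have [kp|pk] := ltnP k p; last by rewrite (chain_eq0 pk Y_last) mem0v.
by rewrite memv_span // mem_cat orbC map_f // mem_iota.
Qed.

End HomogeneousGenerators.

Lemma type_I_adapted (K : numFieldType) (V : vectType K)
    (mul : {bilinear V -> V -> V}) (m p : nat) :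
  zinbiel mul -> naturally_graded mul -> (0 < p)%N -> (p < m)%N ->
  type_I mul m p -> exists x y, adapted mul m p x y.
Proof.
move=> zin nat_gr p0 pm [e [f [ef_basis e_step e_last f_step f_last]]].
have [N [pi pi_gr]] := naturally_graded_grading nat_gr.
have eE i : (i < m)%N -> chain mul (e 1%N) (e 1%N) i = e i.+1.
  by elim: i => // i IHi im; rewrite chainS IHi ?e_step //; lia.
have fE i : (i < p)%N -> chain mul (e 1%N) (f 1%N) i = f i.+1.
  by elim: i => // i IHi ip; rewrite chainS IHi ?f_step //; lia.
exists (pi 1%N (e 1%N)), (pi 1%N (f 1%N)).
apply: (homogeneous_adapted zin pi_gr) => //.
- rewrite [X in X ++ _](_ : _ = [seq e i | i <- iota 1 m]); last first.
    rewrite -[1%N]addn0 iotaDl -map_comp; apply/eq_in_map => i.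
    by rewrite mem_iota => /andP[_ im]; rewrite eE.
  rewrite [X in _ ++ X](_ : _ = [seq f i | i <- iota 1 p]) //.
  rewrite -[1%N]addn0 iotaDl -map_comp; apply/eq_in_map => i.
  by rewrite mem_iota => /andP[_ ip]; rewrite fE.
- have -> : m = m.-1.+1 by lia.
  by rewrite chainS eE ?prednK //; lia.
- have -> : p = p.-1.+1 by lia.
  by rewrite chainS fE ?prednK //; lia.
Qed.

Theorem theorem3p8 (R : realType) (n p : nat)
    (hp : (3 <= p)%N) (hn : (2 * p + 2 <= n)%N) :
  (forall (A : vectType R[i]) (mul : {bilinear A -> A -> A}),
     \dim {:A} = n -> zinbiel mul -> naturally_graded mul ->
     char_seq mul [:: (n - p)%N; p] -> type_I mul (n - p) p ->
     [\/ exists b : R[i], alg_iso mul (algA1 (n - p) p b),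
         alg_iso mul (algA2 R[i] (n - p) p)
       | alg_iso mul (algA3 R[i] (n - p) p)]) /\
  [/\ forall b b' : R[i],
        alg_iso (algA1 (n - p) p b) (algA1 (n - p) p b') -> b = b',
      forall b : R[i], ~ alg_iso (algA1 (n - p) p b) (algA2 R[i] (n - p) p),
      forall b : R[i], ~ alg_iso (algA1 (n - p) p b) (algA3 R[i] (n - p) p)
    & ~ alg_iso (algA2 R[i] (n - p) p) (algA3 R[i] (n - p) p)].
Proof.
have pm2 : (p + 2 <= n - p)%N by lia.
have pm : (p <= n - p)%N by lia.
split=> [A mul _ zin nat_gr _ typeI|].
  have [||x [y xy]] := type_I_adapted zin nat_gr _ _ typeI; [lia | lia |].
  exact: (adapted_classification zin hp pm2 xy).
split.
- exact: (@A1_inj R[i] (n - p) p hp pm).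
- exact: (@A1_not_A2 R[i] (n - p) p hp pm).
- exact: (@A1_not_A3 R[i] (n - p) p hp pm).
- exact: (@A2_not_A3 R[i] (n - p) p hp pm).
Qed.
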